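(* Let $\sigma$ and $w$ be two weights with densities on $\mathbb R^d$, and let $1<p<\infty$. Let $\varepsilon$ be a monotonic increasing function on $[1,\infty)$ which satisfies $$\int_1^\infty \frac{dt}{\varepsilon(t)\,t}=1 .$$ Set $$\lceil \sigma,w\rceil_{p,\varepsilon}:=\sup_{Q\text{ a cube}}\rho_{\sigma,\varepsilon}(Q)\,\langle\sigma\rangle_Q^{p-1}\,\langle w\rangle_Q .$$ Then there holds $$\lVert M_\sigma : L^p(\sigma)\to L^p(w)\rVert\lesssim \lceil \sigma,w\rceil_{p,\varepsilon}^{1/p},$$ where $M_\sigma f:=M(\sigma f)$, and $A\lesssim B$ means that there is an absolute constant $c$ so that $A\le cB$.
   Context: A weight with density is a nonnegative locally integrable function $\sigma$ on $\mathbb R^d$, identified with the measure $\sigma\,dx$; $\sigma(Q)=\int_Q\sigma\,dx$, and $L^p(\sigma)=L^p(\mathbb R^d,\sigma\,dx)$. For a cube $Q$ in $\mathbb R^d$, $\lvert Q\rvert$ is its Lebesgue measure, and $\langle f\rangle_Q=\lvert Q\rvert^{-1}\int_Q f(x)\,dx$. $M$ is the Hardy–Littlewood maximal operator, $Mf(x)=\sup_{Q\ni x}\langle \lvert f\rvert\rangle_Q$, the supremum being over cubes containing $x$. For a weight $\sigma$, a cube $Q$ and an increasing function $\varepsilon$ on $[1,\infty)$, define $$\rho_\sigma(Q)=\frac{\int_Q M(\sigma\mathbf 1_Q)\,dx}{\sigma(Q)},\qquad \rho_{\sigma,\varepsilon}(Q)=\rho_\sigma(Q)\,\varepsilon(\rho_\sigma(Q)).$$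 The norm $\lVert M_\sigma:L^p(\sigma)\to L^p(w)\rVert$ is the best constant $N$ in $\lVert M(\sigma f)\rVert_{L^p(w)}\le N\lVert f\rVert_{L^p(\sigma)}$.
   Formalization: The constant c depends on d, p and a positive lower bound δ of ε(1), with δ ≤ ε(1) assumed; one constant for all ε is impossible: for σ = w = 1 the bracket is ε(1), which can be arbitrarily small with the integral equal to 1, while the norm is at least 1. *)

(* Defs.v *)
From HB Require Import structures.
From mathcomp Require Import all_boot all_order all_algebra.
From mathcomp Require Import all_classical all_reals all_analysis measurable_realfun.

Set Implicit Arguments.
Unset Strict Implicit.
Unset Printing Implicit Defensive.
Import Order.TTheory GRing.Theory Num.Theory.
Import numFieldTopology.Exports numFieldNormedType.Exports.

Local Open Scope classical_set_scope.
Local Open Scope ring_scope.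

(* The sigma-algebra on 'rV[R]_n is the product one, generated by the
   coordinates; it contains every open set (lemma open_measurable_rV). *)
Section measurable_rV.
Context {R : realType} (n : nat).

Let coord : 'I_n -> 'rV[R]_n -> R := fun i x => x ord0 i.

Let rV_set0 : g_sigma_preimage coord set0.
Proof. exact: sigma_algebra0. Qed.

Let rV_setC A : g_sigma_preimage coord A -> g_sigma_preimage coord (~` A).
Proof. exact: sigma_algebraC. Qed.

Let rV_bigcup (F : (set _)^nat) : (forall i, g_sigma_preimage coord (F i)) ->
  g_sigma_preimage coord (\bigcup_i (F i)).
Proof. exact: sigma_algebra_bigcup. Qed.

HB.instance Definition _ := @isMeasurable.Build default_measure_display
  'rV[R]_n (g_sigma_preimage coord) rV_set0 rV_setC rV_bigcup.

End measurable_rV.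

Lemma measurable_coord_rV {R : realType} n (i : 'I_n) :
  measurable_fun [set: 'rV[R]_n] (fun x : 'rV[R]_n => x ord0 i).
Proof.
move=> _ Y mY; rewrite setTI; apply: sub_sigma_algebra => /=.
rewrite -bigcup_seq/=; exists i => /=; first by rewrite mem_index_enum.
by exists Y => //; rewrite setTI.
Qed.

Lemma measurable_fun_rVP {R : realType} d (T : measurableType d) n
    (f : T -> 'rV[R]_n) :
  measurable_fun setT f <-> forall i, measurable_fun setT (fun t => f t ord0 i).
Proof.
split=> [mf i|mf].
  exact: (measurableT_comp (measurable_coord_rV i) mf).
move=> _ A mA; rewrite setTI; move: A mA.
suff : g_sigma_preimage (fun (i : 'I_n) (x : 'rV[R]_n) => x ord0 i) `<=`
    image_set_system setT f measurable.
  by move=> h A /h; rewrite /image_set_system/= setTI.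
apply: smallest_sub.
  exact: sigma_algebra_image (@sigma_algebra_measurable _ T).
rewrite -bigcup_seq => A [i _ [B mB <-]].
rewrite /image_set_system/= !setTI.
by have := mf i measurableT _ mB; rewrite setTI.
Qed.

Lemma measurable_box_rV {R : realType} n (A : 'I_n -> set R) :
  (forall i, measurable (A i)) ->
  measurable [set x : 'rV[R]_n | forall i, A i (x ord0 i)].
Proof.
move=> mA; rewrite (_ : [set _ | _] =
    \bigcap_(i in [set: 'I_n]) (fun x : 'rV[R]_n => x ord0 i) @^-1` A i).
  apply: fin_bigcap_measurable => // i _.
  by have := measurable_coord_rV i measurableT (mA i); rewrite setTI.
by apply/seteqP; split => x /= h i; [move=> _; exact: h|exact: (h i Logic.I)].
Qed.

Lemma open_measurable_rV {R : realType} n (U : set 'rV[R]_n) :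
  open U -> measurable U.
Proof.
move=> oU.
pose B (q : 'rV[rat]_n * 'rV[rat]_n) : set 'rV[R]_n := [set x | forall i,
  x ord0 i \in `]ratr (q.1 ord0 i), ratr (q.2 ord0 i)[%R].
have mB q : measurable (B q).
  by apply: (measurable_box_rV (A := fun i =>
    `]ratr (q.1 ord0 i), ratr (q.2 ord0 i)[%classic)) => i; exact: measurable_itv.
pose C q := if `[< B q `<=` U >] then B q else set0.
have -> : U = \bigcup_q C q.
  apply/seteqP; split => [x Ux|x [q _]]; last first.
    by rewrite /C; case: asboolP => // BU /BU.
  have : nbhs x U by exact: open_nbhs_nbhs.
  rewrite -nbhs_ballE => -[e /= e0 xeU].
  have /choice[a xa] (i : 'I_n) :
      exists q : rat, ratr q \in `]x ord0 i - e, x ord0 i[.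
    by apply: rat_in_itvoo; rewrite ltrBlDr ltrDl.
  have /choice[b xb] (i : 'I_n) :
      exists q : rat, ratr q \in `]x ord0 i, x ord0 i + e[.
    by apply: rat_in_itvoo; rewrite ltrDl.
  exists (\row_i a i, \row_i b i) => //; rewrite /C; case: asboolP => [_|[]].
    move=> i; rewrite /= !mxE in_itv/=.
    by move: (xa i) (xb i); rewrite !in_itv/= => /andP[_ ->] /andP[->].
  move=> y By; apply: xeU; split => // i j; rewrite ord1.
  have := By j; rewrite !mxE in_itv/=.
  move: (xa j) (xb j); rewrite !in_itv/= => /andP[xe _] /andP[_ ex] /andP[ay yb].
  rewrite /ball/= ltr_distlC (lt_trans xe ay)/=.
  exact: lt_trans yb ex.
apply: countable_bigcupT_measurable => // q; rewrite /C.
by case: asboolP => // _; exact: measurable0.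
Qed.

(* (x, (v_1, ..., v_n)) |-> (x, v_1, ..., v_n) *)
Definition cons_rV {R : realType} n (z : R * 'rV[R]_n) : 'rV[R]_n.+1 :=
  row_mx (z.1)%:M z.2.

Definition uncons_rV {R : realType} n (x : 'rV[R]_n.+1) : R * 'rV[R]_n :=
  (x ord0 ord0, \row_j x ord0 (lift ord0 j)).

Lemma cons_rV0 {R : realType} n (z : R * 'rV[R]_n) : cons_rV z ord0 ord0 = z.1.
Proof.
rewrite /cons_rV mxE; case: splitP => // j _.
by rewrite (ord1 j) mxE eqxx mulr1n.
Qed.

Lemma cons_rVS {R : realType} n (z : R * 'rV[R]_n) j :
  cons_rV z ord0 (lift ord0 j) = z.2 ord0 j.
Proof.
rewrite /cons_rV mxE; case: splitP => k /=; first by rewrite ord1.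
by rewrite /bump/= => -[jk]; congr (_ _ _); exact/val_inj.
Qed.

Lemma cons_rVK {R : realType} n : cancel (@cons_rV R n) (@uncons_rV R n).
Proof.
move=> [x v]; rewrite /uncons_rV cons_rV0; congr pair.
by apply/rowP => j; rewrite mxE cons_rVS.
Qed.

Lemma measurable_cons_rV {R : realType} n :
  measurable_fun [set: R * 'rV[R]_n] (@cons_rV R n).
Proof.
apply/measurable_fun_rVP => i.
case: (unliftP ord0 i) => [j|] ->.
  under eq_fun do rewrite cons_rVS.
  by apply: (measurableT_comp (measurable_coord_rV j)); exact: measurable_snd.
by under eq_fun do rewrite cons_rV0; exact: measurable_fst.
Qed.

Lemma measurable_uncons_rV {R : realType} n :
  measurable_fun [set: 'rV[R]_n.+1] (@uncons_rV R n).
Proof.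
apply/measurable_fun_pair; first exact: measurable_coord_rV.
apply/measurable_fun_rVP => j; under eq_fun do rewrite mxE.
exact: measurable_coord_rV.
Qed.

Section lebesgue_step.
Local Open Scope ereal_scope.
Context {R : realType} {n : nat}.
Variable mu : {sigma_finite_measure set 'rV[R]_n -> \bar R}.

Definition lebesgue_step (A : set 'rV[R]_n.+1) : \bar R :=
  (@lebesgue_measure R \x mu) (@cons_rV R n @^-1` A).

Let mcons A : measurable A ->
  measurable (@cons_rV R n @^-1` A : set (measurableTypeR R * 'rV[R]_n)).
Proof. by move=> mA; have := @measurable_cons_rV R n measurableT _ mA; rewrite setTI. Qed.

Let step0 : lebesgue_step set0 = 0.
Proof. by rewrite /lebesgue_step preimage_set0 measure0. Qed.

Let step_ge0 A : 0 <= lebesgue_step A.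
Proof. exact: measure_ge0. Qed.

Let step_sigma_additive : semi_sigma_additive lebesgue_step.
Proof.
move=> F mF tF mUF; rewrite /lebesgue_step preimage_bigcup.
apply: measure_semi_sigma_additive.
- by move=> k; exact: mcons.
- apply/trivIsetP => /= i j _ _ ij; rewrite -preimage_setI.
  by move/trivIsetP : tF => /(_ _ _ _ _ ij) ->//; rewrite preimage_set0.
- by rewrite -preimage_bigcup; exact: mcons.
Qed.

HB.instance Definition _ := isMeasure.Build _ _ _ lebesgue_step
  step0 step_ge0 step_sigma_additive.

Let step_sigma_finite : sigma_finite setT lebesgue_step.
Proof.
have /sigma_finiteP[F [FT ndF Foo]] := sigma_finiteT (@lebesgue_measure R).
have /sigma_finiteP[G [GT ndG Goo]] := sigma_finiteT mu.
exists (fun k => @uncons_rV R n @^-1` (F k `*` G k)).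
  apply/seteqP; split => // x _.
  have [k _ Fk] : (\bigcup_k F k) (uncons_rV x).1 by rewrite -FT.
  have [l _ Gl] : (\bigcup_k G k) (uncons_rV x).2 by rewrite -GT.
  exists (maxn k l) => //; split.
    by move: (uncons_rV x).1 Fk; exact/subsetPset/ndF/leq_maxl.
  by move: (uncons_rV x).2 Gl; exact/subsetPset/ndG/leq_maxr.
move=> k; have [mF Fk] := Foo k; have [mG Gk] := Goo k.
have mFG : measurable (F k `*` G k) by exact: measurableX.
split.
  by have := @measurable_uncons_rV R n measurableT _ mFG; rewrite setTI.
rewrite /lebesgue_step (_ : _ @^-1` _ = F k `*` G k).
  by rewrite product_measure1E// lte_mul_pinfty// ge0_fin_numE.
by apply/funext => z; exact: (congr1 (F k `*` G k) (cons_rVK z)).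
Qed.

HB.instance Definition _ := Measure_isSigmaFinite.Build _ _ _ lebesgue_step
  step_sigma_finite.

End lebesgue_step.

(* Lebesgue measure on Borel sets, as an iterated product; its value on boxes is
   lemma lebesgue_rV_box. *)
Fixpoint lebesgue_rV {R : realType} (n : nat) :
    {sigma_finite_measure set 'rV[R]_n -> \bar R} :=
  match n with
  | 0 => \d_(0 : 'rV[R]_0)
  | n'.+1 => lebesgue_step (lebesgue_rV n')
  end.

Lemma lebesgue_rV_box {R : realType} n (A : 'I_n -> set R) :
  (forall i, measurable (A i)) ->
  lebesgue_rV n [set x : 'rV[R]_n | forall i, A i (x ord0 i)] =
  (\prod_(i < n) (@lebesgue_measure R (A i)))%E.
Proof.
elim: n A => [|n IH] A mA.
  rewrite big_ord0 /= diracE mem_set//= => -[]//.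
rewrite big_ord_recl /= -IH; last by move=> i; exact: mA.
rewrite /lebesgue_step -product_measure1E; [|exact: mA|]; last first.
  by apply: (measurable_box_rV (A := fun i => A (lift ord0 i))) => i; exact: mA.
congr (_ _); apply/seteqP; split => -[x v] /=.
  move=> h; split; first by have := h ord0; rewrite cons_rV0.
  by move=> i; have := h (lift ord0 i); rewrite cons_rVS.
move=> [h0 hS] i; case: (unliftP ord0 i) => [j|] ->.
  by rewrite cons_rVS; exact: hS.
by rewrite cons_rV0.
Qed.

Section locally_integrable_rV.
Local Open Scope ereal_scope.
Context {R : realType} {d : nat}.
Local Notation T := 'rV[R]_d.
Local Notation mu := (lebesgue_rV d).

Definition locally_integrable_rV (f : T -> R) :=
  measurable_fun setT f /\
  forall K : set T, compact K -> \int[mu]_(x in K) `|f x|%:E < +oo.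

End locally_integrable_rV.

Record weight (R : realType) (d : nat) := Weight {
  density :> 'rV[R]_d -> R ;
  density_ge0 : forall x, 0 <= density x ;
  density_locally_integrable : locally_integrable_rV density }.

Section weight_measure.
Local Open Scope ereal_scope.
Context {R : realType} {d : nat}.
Variable s : weight R d.

Definition weight_measure (A : set 'rV[R]_d) : \bar R :=
  \int[lebesgue_rV d]_(x in A) (s x)%:E.

Let weight0 : weight_measure set0 = 0.
Proof. exact: integral_set0. Qed.

Let weight_ge0 A : 0 <= weight_measure A.
Proof. by apply: integral_ge0 => x _; rewrite lee_fin density_ge0. Qed.

Let weight_sigma_additive : semi_sigma_additive weight_measure.
Proof.
apply: semi_sigma_additive_nng_induced => [|x].
  by apply/measurable_EFinP; exact: (density_locally_integrable s).1.
by rewrite lee_fin density_ge0.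
Qed.

HB.instance Definition _ := isMeasure.Build _ _ _ weight_measure
  weight0 weight_ge0 weight_sigma_additive.

End weight_measure.

Section maximal.
Local Open Scope ereal_scope.
Context {R : realType} {d : nat}.
Local Notation T := 'rV[R]_d.
Local Notation mu := (lebesgue_rV d).

(* Cubes have sides parallel to the axes and are half-open. Lebesgue measure does
   not charge their boundary, and a cube containing x can be enlarged slightly to
   contain x in its interior, so open or closed cubes would give the same averages
   and the same maximal function. *)
Definition cube (a : T) (l : R) : set T :=
  [set x : T | forall i, x ord0 i \in `[a ord0 i, (a ord0 i + l)%R[ ].

Definition cubes : set (set T) :=
  [set Q | exists2 l : R, (0 < l)%R & exists a : T, Q = cube a l].

Definition average (f : T -> R) (Q : set T) : \bar R :=
  (mu Q)^-1 * \int[mu]_(x in Q) (f x)%:E.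

Definition maximal (f : T -> R) (x : T) : \bar R :=
  ereal_sup [set average (fun y => `|f y|%R) Q | Q in cubes `&` [set Q | Q x]].

(* The best constant N in |M(s f)|_{L^p(w)} <= N |f|_{L^p(s)}; it is +oo when no
   finite N works. *)
Definition maximal_norm (s w : weight R d) (p : R) : \bar R :=
  ereal_inf [set N%:E | N in [set N : R | (0 <= N)%R /\
    forall f : T -> R, f \in Lfun (weight_measure s) p%:E ->
      'N[weight_measure w]_p%:E[maximal (s \* f)%R] <=
      N%:E * 'N[weight_measure s]_p%:E[EFin \o f]]].

(* When s vanishes a.e. on Q this reads 0 / 0 = 0; such a cube contributes 0 to
   entropy_bump, whatever the value of eps at 0. *)
Definition rho (s : weight R d) (Q : set T) : \bar R :=
  (\int[mu]_(x in Q) maximal (s \* \1_Q)%R x) / weight_measure s Q.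

(* rho s Q is +oo when M (s 1_Q) is not integrable on Q; as eps is positive and
   nondecreasing, rho * eps(rho) is then +oo. *)
Definition rho_eps (s : weight R d) (eps : R -> R) (Q : set T) : \bar R :=
  if rho s Q is r%:E then (r * eps r)%:E else +oo.

(* The usual convention 0 * +oo = 0 of \bar R applies to the products. *)
Definition entropy_bump (s w : weight R d) (p : R) (eps : R -> R) : \bar R :=
  ereal_sup [set rho_eps s eps Q * average s Q `^ (p - 1) * average w Q
            | Q in cubes].

End maximal.

Lemma lebesgue_cube {R : realType} n (a : 'rV[R]_n) (l : R) : 0 < l ->
  lebesgue_rV n (cube a l) = (l ^+ n)%:E.
Proof.
move=> l0; rewrite /cube (lebesgue_rV_box (A := fun i =>
  `[a ord0 i, (a ord0 i + l)%R[%classic)); last first.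
  by move=> i; exact: measurable_itv.
under eq_bigr do rewrite
  lebesgue_measure_itv/= lte_fin ltrDl l0 -EFinB addrAC subrr add0r.
rewrite big_const_ord; elim: n {a} => [|n IH] //=.
by rewrite IH -EFinM exprS.
Qed.

(* Main.v *)
Require Import Defs.
From HB Require Import structures.
From mathcomp Require Import all_boot all_order all_algebra.
From mathcomp Require Import all_classical all_reals all_analysis.
From mathcomp Require Import measurable_realfun zify ring lra.

(** Why the theorem holds.

    _Reduction to a finite dyadic tree._  Let a root cube be a cube of side
    [3 * 2^n], translated by a third of its side in some of the coordinates.
    For all large [n], a given cube of side [l] lies in a dyadic descendant,
    of side at most [6 * l], of one of the [2^d] roots
    ([cover_by_descendant]).  So [M(sigma f)^p] is at most a constant times the
    lower limit in [n] of the sum over the roots of the [p]-th powers of finite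
    dyadic maximal functions ([maximal_le_liminf]), and by Fatou's lemma it
    suffices to bound one such function, over one root, with a constant that
    depends neither on the root nor on the number of generations
    ([dyadic_bound]).

    _The Bellman function._  Write [|Q|] for the volume, [s(Q)] for the sigma
    mass, [phi(Q)] for the integral of [|f|] and [F(Q)] for that of [|f|^p], both
    against sigma.  Walking down the tree, keep a stopping value [t] that is
    replaced by the average [phi(Q) / |Q|] whenever this exceeds [2 t]; call the
    cubes where this happens selected.  Twice the stopping value dominates the
    dyadic maximal function, so its [p]-th power is paid for by the terms
    [(phi(Q) / |Q|)^p w(Q)] of the selected cubes.  By the bump condition such a
    term is at most [K (phi(Q) / s(Q))^p s(Q) / (rho eps(rho))], where [K] is the
    bump constant and [rho >= 1] because [Q] itself competes in the maximal
    function of [sigma 1_Q].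

    Let [Y(Q)] be the total sigma mass of the selected subcubes of [Q].  Averages
    at least double from one selected cube to the next, so the selected cubes
    are sparse for Lebesgue measure, and [Y(Q) <= 2 rho(Q) s(Q)]
    ([stopped_mass_le]).  Let [G] be the primitive, vanishing at [0], of
    [x |-> 1 / (r eps(r))] with [r = max(1, x / 2)]; it is concave, and the
    integral condition on [eps] makes it bounded.  Put

      [m(Q) = s(Q) (1 + G (Y(Q) / s(Q)))]  and
      [B(Q) = F(Q) - phi(Q)^p / m(Q)^(p-1)].

    As [G] is concave and [(phi, m) |-> phi^p / m^(p-1)] is convex and
    homogeneous of degree one, the sum of [B] over the children of [Q] is at most [B(Q)].  At
    a selected cube [Y] moreover jumps by [s(Q)], so [m] jumps by at least
    [s(Q) / (rho eps(rho))]; as [m] is comparable with [s], the drop of [B] pays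
    for the term of [Q] ([bellman_step]).  Summing over the tree bounds everything
    by a multiple of [K F(root)].  This single function takes the place of a
    splitting of the cubes by the size of [rho], of the Carleson embedding
    theorem and of the maximal theorem for the measure sigma. *)

Set Implicit Arguments.
Unset Strict Implicit.
Unset Printing Implicit Defensive.
Import Order.TTheory GRing.Theory Num.Theory.
Import numFieldTopology.Exports numFieldNormedType.Exports.
Local Open Scope classical_set_scope.
Local Open Scope ring_scope.

(** * The function phi^p / m^(p-1) *)

Section perspective.
Context {R : realType}.
Implicit Types a z p r : R.

Lemma powR_pred p z : p != 0 -> 0 <= z -> z * z `^ (p - 1) = z `^ p.
Proof.
move=> p0; rewrite le_eqVlt => /predU1P[<-|z0].
  by rewrite mul0r powR0.
rewrite -{1}(powRr1 (ltW z0)) -powRD; first by rewrite subrKC.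
by rewrite (gt_eqF z0) implybT.
Qed.

Lemma powRV a r : 0 <= a -> a^-1 `^ r = (a `^ r)^-1.
Proof. by move=> a0; rewrite -powR_inv1// -powRrM mulN1r powRN. Qed.

(** The graph of the convex function [a |-> a^p] lies above its tangent at [z];
    this is Young's inequality for the exponents [p] and [p / (p - 1)]. *)
Lemma powR_tangent p a z : 1 < p -> 0 <= a -> 0 <= z ->
  p * z `^ (p - 1) * a - (p - 1) * z `^ p <= a `^ p.
Proof.
move=> p1 a0 z0; have p0 : 0 < p by exact: lt_trans p1.
have q0 : 0 < p - 1 by rewrite subr_gt0.
have := @conjugate_powR R a (z `^ (p - 1)) p (p / (p - 1)) a0 (powR_ge0 _ _) p0.
rewrite divr_gt0// -powRrM mulrCA divff ?gt_eqF// mulr1 => /(_ isT).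
have -> : p^-1 + (p / (p - 1))^-1 = 1 by field; rewrite !gt_eqF.
move=> /(_ erefl) H.
have {}H : p * (a * z `^ (p - 1)) <= p * (a `^ p / p + z `^ p / (p / (p - 1))).
  by rewrite ler_pM2l.
have : p * (a `^ p / p + z `^ p / (p / (p - 1))) = a `^ p + (p - 1) * z `^ p.
  by field; rewrite !gt_eqF.
move=> E; rewrite E in H; lra.
Qed.

(** The perspective of [t |-> t^p]: convex and homogeneous of degree one. *)
Definition persp (p phi m : R) : R := phi `^ p / m `^ (p - 1).

(** Convexity and homogeneity, in the form used below: the tangent plane at a
    point of slope [z = phi / m] is linear and touches the graph along a whole
    ray ([persp_tangentE]), so that summing this bound over the children of a
    cube gives superadditivity without any division. *)
Lemma persp_tangent (p phi m z : R) : 1 < p -> 0 <= phi -> 0 <= m ->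
  (m = 0 -> phi = 0) -> 0 <= z ->
  p * z `^ (p - 1) * phi - (p - 1) * z `^ p * m <= persp p phi m.
Proof.
move=> p1 phi0 m0 m0phi z0; have p0 : 0 < p by exact: lt_trans p1.
move: m0; rewrite le_eqVlt => /predU1P[/esym m0|m0].
  by rewrite /persp m0phi// m0 powR0 ?gt_eqF// !mulr0 mul0r subr0.
have := powR_tangent p1 (divr_ge0 phi0 (ltW m0)) z0.
rewrite -(ler_pM2l m0) => H.
have -> : p * z `^ (p - 1) * phi - (p - 1) * z `^ p * m =
    m * (p * z `^ (p - 1) * (phi / m) - (p - 1) * z `^ p).
  by field; rewrite gt_eqF.
apply: le_trans H _; rewrite /persp powRM ?invr_ge0 ?(ltW m0)//.
rewrite powRV ?(ltW m0)// -(@powR_pred p _ _ (ltW m0)) ?gt_eqF//.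
rewrite le_eqVlt; apply/orP; left; apply/eqP; field.
by rewrite !gt_eqF ?powR_gt0.
Qed.

Lemma persp_tangentE (p phi m : R) : 1 < p -> 0 < phi -> 0 < m ->
  p * (phi / m) `^ (p - 1) * phi - (p - 1) * (phi / m) `^ p * m = persp p phi m.
Proof.
move=> p1 phi0 m0; have p0 : 0 < p by exact: lt_trans p1.
have z0 : 0 <= phi / m by rewrite divr_ge0 ?(ltW phi0) ?(ltW m0).
rewrite -(@powR_pred p _ _ z0) ?(gt_eqF p0)// /persp.
rewrite -(@powR_pred p _ _ (ltW phi0)) ?(gt_eqF p0)//.
rewrite powRM ?invr_ge0 ?(ltW phi0) ?(ltW m0)// powRV ?(ltW m0)//; field.
by rewrite !gt_eqF ?powR_gt0.
Qed.

End perspective.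

(** * Bellman induction on a finite tree *)

Section cells.
Context {R : realType} {I : Type} {B : finType} (child : I -> B -> I).

(** A tree is a type of nodes with children indexed by a finite type; the number
    of generations that are looked at is a separate argument of the functions
    below, so that the tree itself may be infinite. *)
Definition tree_additive (m : I -> R) := forall Q, m Q = \sum_b m (child Q b).

(** The integral over [Q] of [H] applied to the maximum of [v] and of the
    averages over the first [h] generations of descendants, against the measure
    [m]; see [integral_dyadic_max].  Recording it as a recursion on numbers separates the
    Bellman induction from measure theory. *)
Fixpoint max_integral (H : R -> R) (m avg : I -> R) h (v : R) Q : R :=
  if h is h'.+1
  then \sum_b max_integral H m avg h' (Num.max v (avg Q)) (child Q b)
  else H v * m Q.

Lemma le_max_integral H m avg h (v1 v2 : R) Q :
  (forall x y : R, 0 <= x -> x <= y -> H x <= H y) -> (forall P, 0 <= m P) ->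
  0 <= v1 -> v1 <= v2 ->
  max_integral H m avg h v1 Q <= max_integral H m avg h v2 Q.
Proof.
move=> Hnd m0; elim: h v1 v2 Q => [|h IH] v1 v2 Q v10 v12 /=.
  by rewrite ler_wpM2r// Hnd.
apply: ler_sum => b _; apply: IH; first by rewrite le_max v10.
by rewrite ge_max !le_max v12/= lexx orbT.
Qed.

Section stopping.
Context (leb phi s : I -> R).

(** The sum of [s] over the selected cubes below [Q], when the walk arrives at
    [Q] with stopping value [t]. *)
Fixpoint stopped_mass h (t : R) Q : R :=
  if h is h'.+1 then
    if 2 * t < phi Q / leb Q
    then s Q + \sum_b stopped_mass h' (phi Q / leb Q) (child Q b)
    else \sum_b stopped_mass h' t (child Q b)
  else 0.

Hypotheses (leb_gt0 : forall Q, 0 < leb Q) (s_ge0 : forall Q, 0 <= s Q)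
  (phi_ge0 : forall Q, 0 <= phi Q)
  (leb_add : tree_additive leb) (phi_add : tree_additive phi)
  (s_add : tree_additive s).

Let s_child Q b : s (child Q b) <= s Q.
Proof. by rewrite [s Q]s_add (bigD1 b)//= lerDl sumr_ge0. Qed.

Lemma stopped_mass_ge0 h (t : R) Q : 0 <= stopped_mass h t Q.
Proof.
elim: h t Q => //= h IH t Q; case: ifP => _; last exact: sumr_ge0.
by rewrite addr_ge0// sumr_ge0.
Qed.

Let savg Q := s Q / leb Q.
Local Notation U := (max_integral idfun leb savg).

Let savg_ge0 Q : 0 <= savg Q.
Proof. by rewrite divr_ge0// ltW. Qed.

(** Sparsity.  In the induction the part of [Q] that the next selected cubes
    leave free has volume at least [leb Q - phi Q / (2 t)], since their averages
    exceed [2 t]; on the free part the running maximum [v] is still available to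
    pay.  At a selected cube the correction is negative for the incoming [t] and
    equal to half the volume for the outgoing one, so that [2 u] times it covers
    [s Q], the new running maximum [u] being at least the average of [s]. *)
Lemma stopped_mass_max h (t v : R) Q : 0 < t -> 0 <= v ->
  stopped_mass h t Q + 2 * v * (leb Q - phi Q / (2 * t)) <= 2 * U h v Q.
Proof.
elim: h t v Q => [|h IH] t v Q t0 v0 /=.
  rewrite add0r -mulrA ler_pM2l// ler_wpM2l// gerBl.
  by rewrite divr_ge0// mulr_ge0// ltW.
set u := Num.max v (savg Q).
have u0 : 0 <= u by rewrite le_max v0.
have IHs tt : 0 < tt -> \sum_b stopped_mass h tt (child Q b) +
    2 * u * (leb Q - phi Q / (2 * tt)) <= 2 * \sum_b U h u (child Q b).
  move=> tt0; rewrite [leb Q]leb_add [phi Q]phi_add mulr_suml -sumrB !mulr_sumr.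
  by rewrite -big_split; apply: ler_sum => b _; exact: IH.
have vu : v <= u by rewrite le_max lexx.
case: ltP => [tA|At].
  have A0 : 0 < phi Q / leb Q by apply: lt_trans tA; rewrite mulr_gt0.
  apply: le_trans (IHs _ A0).
  have -> : phi Q / (2 * (phi Q / leb Q)) = leb Q / 2.
    field; rewrite gt_eqF//=.
    by move: A0; rewrite pmulr_lgt0 ?invr_gt0// => /gt_eqF ->.
  have us : s Q <= u * leb Q.
    by rewrite -ler_pdivrMr// le_max lexx orbT.
  have : 2 * v * (leb Q - phi Q / (2 * t)) <= 0.
    rewrite mulr_ge0_le0 ?mulr_ge0// subr_le0 ler_pdivlMr ?mulr_gt0//.
    by move: tA; rewrite ltr_pdivlMr// => /ltW; rewrite mulrC.
  nra.
apply: le_trans (IHs _ t0); rewrite lerD2l ler_wpM2r//; last by rewrite ler_pM2l.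
rewrite subr_ge0 ler_pdivrMr ?mulr_gt0// mulrC.
by move: At; rewrite ler_pdivrMr.
Qed.

(** The case [v = 0] of the sparsity estimate; stated apart because the walk
    starts at the root with [t = 0]. *)
Lemma stopped_mass_le h (t : R) Q : 0 <= t -> stopped_mass h t Q <= 2 * U h 0 Q.
Proof.
rewrite le_eqVlt => /predU1P[<-|t0]; last first.
  by have := stopped_mass_max h Q t0 (lexx 0); rewrite mulr0 mul0r addr0.
elim: h Q => [|h IH] Q /=; first by rewrite mul0r mulr0.
rewrite mulr0 max_r//; case: ltP => [A0|_].
  have := leb_gt0 Q => lQ.
  have H : \sum_b stopped_mass h (phi Q / leb Q) (child Q b) +
      2 * savg Q * (leb Q - phi Q / (2 * (phi Q / leb Q)))
      <= 2 * \sum_b U h (savg Q) (child Q b).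
    rewrite [X in _ * (X - _)]leb_add [X in X / (_ * _)]phi_add mulr_suml -sumrB.
    rewrite !mulr_sumr -big_split.
    by apply: ler_sum => b _; exact: stopped_mass_max.
  apply: le_trans H; rewrite addrC lerD2l.
  have -> : phi Q / (2 * (phi Q / leb Q)) = leb Q / 2.
    field; rewrite gt_eqF//=.
    by move: A0; rewrite pmulr_lgt0 ?invr_gt0// => /gt_eqF ->.
  rewrite /savg le_eqVlt; apply/orP; left; apply/eqP; field.
  by rewrite gt_eqF.
rewrite mulr_sumr; apply: ler_sum => b _; apply: le_trans (IH _) _.
rewrite ler_pM2l// le_max_integral// => P; exact: ltW.
Qed.

Section bellman.
Context (F w : I -> R) (p K C0 : R) (G gam : R -> R).
Hypotheses (p1 : 1 < p) (K0 : 0 <= K)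
  (w_ge0 : forall Q, 0 <= w Q) (F_add : tree_additive F) (w_add : tree_additive w)
  (s0phi : forall Q, s Q = 0 -> phi Q = 0)
  (F_phi : forall Q, persp p (phi Q) (s Q) <= F Q)
  (G0 : G 0 = 0) (GC0 : forall x : R, 0 <= x -> G x <= C0)
  (gam_ge0 : forall x : R, 0 <= x -> 0 <= gam x)
  (gam_noninc : forall x y : R, 0 <= x -> x <= y -> gam y <= gam x)
  (G_gam : forall x y : R, 0 <= x -> 0 <= y -> G y <= G x + gam x * (y - x))
  (w_bump : forall h Q, 0 < s Q ->
    w Q / leb Q * (s Q / leb Q) `^ (p - 1) <= K * gam (2 * U h 0 Q / s Q)).

Let p0 : 0 < p. Proof. exact: lt_trans p1. Qed.
Let q0 : 0 < p - 1. Proof. by rewrite subr_gt0. Qed.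

Lemma concave_ge0 (x : R) : 0 <= x -> 0 <= G x.
Proof.
move=> x0; have := G_gam x0 (lexx 0); rewrite G0 sub0r mulrN subr_ge0.
by apply: le_trans; rewrite mulr_ge0// gam_ge0.
Qed.

Lemma C0_ge0 : 0 <= C0.
Proof. by rewrite -G0; exact: GC0. Qed.

(** The quantity [m(Q)]: comparable with [s Q] because [G] is bounded, and
    increased at each selected cube because [G] is increasing. *)
Definition bell_mass h (t : R) Q := s Q * (1 + G (stopped_mass h t Q / s Q)).

Let Ys_ge0 h (t : R) Q : 0 <= stopped_mass h t Q / s Q.
Proof. by rewrite divr_ge0// stopped_mass_ge0. Qed.

Lemma bell_mass_ge0 h (t : R) Q : 0 <= bell_mass h t Q.
Proof. by rewrite mulr_ge0// addr_ge0// concave_ge0. Qed.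

Lemma bell_mass_eq0 h (t : R) Q : bell_mass h t Q = 0 -> phi Q = 0.
Proof.
move/eqP; rewrite mulf_eq0 => /orP[/eqP/s0phi//|].
by rewrite gt_eqF// ltr_pwDl// concave_ge0.
Qed.

(** Jensen's inequality for the concave [G], proved with its tangent at the mean
    [x]: the right-hand side is the value that [m] would have at [Q] without
    the jump of the stopped mass there. *)
Lemma sum_bell_mass h (t : R) Q (Y := \sum_b stopped_mass h t (child Q b)) :
  \sum_b bell_mass h t (child Q b) <= s Q * (1 + G (Y / s Q)).
Proof.
have Y0 : 0 <= Y by rewrite sumr_ge0// => b _; exact: stopped_mass_ge0.
have [s0|s0] := eqVneq (s Q) 0.
  rewrite s0 mul0r big1// => b _; rewrite /bell_mass.
  suff -> : s (child Q b) = 0 by rewrite mul0r.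
  by apply/eqP; rewrite eq_le s_ge0 andbT -s0 s_child.
have sQ : 0 < s Q by rewrite lt_def s0 s_ge0.
set x := Y / s Q; have x0 : 0 <= x by rewrite divr_ge0.
apply: (@le_trans _ _ (\sum_b (s (child Q b) * (1 + G x - gam x * x) +
    gam x * stopped_mass h t (child Q b)))).
  apply: ler_sum => b _; rewrite /bell_mass.
  have [sb0|sb0] := eqVneq (s (child Q b)) 0.
    by rewrite sb0 !mul0r add0r mulr_ge0 ?gam_ge0 ?stopped_mass_ge0.
  have := G_gam x0 (Ys_ge0 h t (child Q b)).
  move=> /(ler_wpM2l (s_ge0 (child Q b))).
  set y := stopped_mass _ _ _ => H.
  have E : s (child Q b) * (y / s (child Q b)) = y by rewrite mulrC divfK.
  set yb := y / s (child Q b) in H E *.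
  by rewrite -E; lra.
rewrite big_split /= -mulr_suml -mulr_sumr -s_add -/Y.
have E : Y = s Q * x by rewrite mulrC divfK.
by rewrite E le_eqVlt; apply/orP; left; apply/eqP; ring.
Qed.

(* [(1 + C0)^p] compares [(phi / s)^p] with [(phi / m)^p], and [p - 1] is the
   factor of the gain in [persp_superadd]. *)
Let C := (1 + C0) `^ p / (p - 1).

(** Superadditivity of the perspective over the children, with its gain: all
    children are compared with the tangent plane at the slope of [Q], so
    that the excess of [m] over the sum of its values at the children comes back
    with the factor [(p - 1) (phi / m)^p]. *)
Lemma persp_superadd h (t t' : R) Q (m := bell_mass h.+1 t Q)
    (M := \sum_b bell_mass h t' (child Q b)) :
  persp p (phi Q) m + (p - 1) * (phi Q / m) `^ p * (m - M) <=
  \sum_b persp p (phi (child Q b)) (bell_mass h t' (child Q b)).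
Proof.
have [phi0|phi0] := eqVneq (phi Q) 0.
  rewrite /persp phi0 mul0r powR0 ?gt_eqF// mulr0 !mul0r addr0 sumr_ge0// => b _.
  by rewrite mulr_ge0 ?invr_ge0 ?powR_ge0.
have phiQ : 0 < phi Q by rewrite lt_def phi0 phi_ge0.
have mQ : 0 < m.
  rewrite lt_def bell_mass_ge0 andbT; apply: contra_neq phi0.
  exact: bell_mass_eq0.
rewrite -persp_tangentE//.
set z := phi Q / m; have z0 : 0 <= z by rewrite divr_ge0// ltW.
rewrite [phi Q in X in X <= _]phi_add /M.
apply: (@le_trans _ _ (\sum_b (p * z `^ (p - 1) * phi (child Q b) -
    (p - 1) * z `^ p * bell_mass h t' (child Q b)))).
  rewrite sumrB -!mulr_sumr le_eqVlt; apply/orP; left; apply/eqP; ring.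
apply: ler_sum => b _; apply: persp_tangent => //; first exact: bell_mass_ge0.
exact: bell_mass_eq0.
Qed.

(** The induction described at the top.  Only at a selected cube is there
    something to pay, namely [A^p w(Q)] with [A] the average of [phi]; it is paid
    by the gain in [persp_superadd], bounded below through the jump of [m]. *)
Theorem bellman_step h (t : R) Q : 0 <= t ->
  max_integral (fun v => v `^ p) w (fun Q => phi Q / leb Q) h (2 * t) Q <=
  (2 * t) `^ p * w Q +
  2 `^ p * C * K * (F Q - persp p (phi Q) (bell_mass h t Q)).
Proof.
have CK0 : 0 <= 2 `^ p * C * K.
  by rewrite !mulr_ge0 ?powR_ge0// invr_ge0 ltW.
elim: h t Q => [|h IH] t Q t0 /=.
  rewrite lerDl mulr_ge0// subr_ge0 /bell_mass /= mul0r G0 addr0 mulr1.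
  exact: F_phi.
set A := phi Q / leb Q.
have A0 : 0 <= A by rewrite divr_ge0// ltW.
have sums t' : 0 <= t' ->
    \sum_b max_integral (fun v => v `^ p) w (fun Q => phi Q / leb Q) h
      (2 * t') (child Q b) <= (2 * t') `^ p * w Q + 2 `^ p * C * K *
      (F Q - \sum_b persp p (phi (child Q b)) (bell_mass h t' (child Q b))).
  move=> t'0; rewrite [w Q]w_add [F Q]F_add -sumrB !mulr_sumr -big_split.
  by apply: ler_sum => b _; exact: IH.
case: (ltP (2 * t) A) => [tA|At].
  have /= := persp_superadd h t A Q.
  set m := bell_mass h.+1 t Q; set M := \sum_b bell_mass h A (child Q b).
  set S := \sum_b persp p (phi (child Q b)) (bell_mass h A (child Q b)).
  move=> HS; apply: (@le_trans _ _ (\sum_b max_integral (fun v => v `^ p) w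
      (fun Q => phi Q / leb Q) h (2 * A) (child Q b))).
    apply: ler_sum => b _; apply: le_max_integral => //;
      last by rewrite ler_peMl// ler1n.
    by move=> x y x0 xy; rewrite ge0_ler_powR ?nnegrE ?(ltW p0)// (le_trans x0).
  apply: le_trans (sums _ A0) _; rewrite -/S.
  have sQ : 0 < s Q.
    rewrite lt_def s_ge0 andbT; apply: contraTneq tA => /s0phi phi0.
    by rewrite /A phi0 mul0r -leNgt mulr_ge0.
  have phiQ : 0 < phi Q.
    have : 0 < A by apply: le_lt_trans tA; rewrite mulr_ge0.
    by rewrite /A pmulr_lgt0 ?invr_gt0.
  have lQ := leb_gt0 Q.
  have mQ : 0 < m.
    rewrite lt_def bell_mass_ge0 andbT.
    apply: contraTneq phiQ => /bell_mass_eq0 ->.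
    by rewrite ltxx.
  set Y := stopped_mass h.+1 t Q.
  have Y0 : 0 <= Y := stopped_mass_ge0 _ _ _.
  have mM : s Q * gam (2 * U h.+1 0 Q / s Q) <= m - M.
    have := sum_bell_mass h A Q; rewrite -/M.
    have EY : Y = s Q + \sum_b stopped_mass h A (child Q b).
      by rewrite /Y /= -/A tA.
    set Y' := \sum_b _ in EY * => HM.
    have Y'0 : 0 <= Y' by rewrite sumr_ge0// => b _; exact: stopped_mass_ge0.
    have x0 : 0 <= Y / s Q by rewrite divr_ge0.
    have x'0 : 0 <= Y' / s Q by rewrite divr_ge0.
    have := G_gam x0 x'0; have -> : Y' / s Q - Y / s Q = -1.
      by rewrite EY; field; rewrite gt_eqF.
    move=> HG.
    have HY : gam (2 * U h.+1 0 Q / s Q) <= gam (Y / s Q).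
      by apply: gam_noninc => //; rewrite ler_pM2r ?invr_gt0// stopped_mass_le.
    have -> : m = s Q * (1 + G (Y / s Q)) by [].
    apply: (@le_trans _ _ (s Q * gam (Y / s Q))); first by rewrite ler_pM2l.
    apply: (@le_trans _ _ (s Q * (1 + G (Y / s Q)) - s Q * (1 + G (Y' / s Q)))).
      by rewrite -mulrBr ler_pM2l//; lra.
    by rewrite lerB.
  have m_le : m <= s Q * (1 + C0).
    by rewrite ler_pM2l// lerD2l GC0// divr_ge0.
  have key : A `^ p * w Q <= C * K * ((p - 1) * (phi Q / m) `^ p * (m - M)).
    apply: (@le_trans _ _ ((1 + C0) `^ p * K * ((phi Q / m) `^ p *
        (s Q * gam (2 * U h.+1 0 Q / s Q))))); last first.
      rewrite /C; have E a b c : (1 + C0) `^ p / (p - 1) * a * ((p - 1) * b * c) =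
          (1 + C0) `^ p * a * (b * c) by field; rewrite gt_eqF.
      rewrite E ler_wpM2l ?mulr_ge0 ?powR_ge0//.
      by rewrite ler_wpM2l ?powR_ge0.
    have zz : (phi Q / s Q) `^ p <= (1 + C0) `^ p * (phi Q / m) `^ p.
      have C01 : 0 < 1 + C0 by rewrite ltr_pwDl// C0_ge0.
      rewrite -powRM ?(ltW C01) ?divr_ge0// ?(ltW mQ)//.
      rewrite ge0_ler_powR ?nnegrE ?(ltW p0)// ?divr_ge0//.
        by rewrite mulr_ge0 ?divr_ge0// ltW.
      rewrite ler_pdivrMr// mulrAC mulrA ler_pdivlMr// mulrC.
      by rewrite ler_pM2r// (mulrC (1 + C0)).
    have HA : A `^ p * w Q = (phi Q / s Q) `^ p *
        (w Q / leb Q * (s Q / leb Q) `^ (p - 1) * s Q).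
      have -> : A = (phi Q / s Q) * (s Q / leb Q).
        by rewrite /A; field; rewrite !gt_eqF.
      rewrite powRM ?divr_ge0// ?(ltW lQ)// -mulrA; congr (_ * _).
      rewrite -(@powR_pred _ p _ _ (divr_ge0 (s_ge0 Q) (ltW lQ))) ?gt_eqF//.
      by field; rewrite gt_eqF.
    rewrite HA; set g := gam _.
    have := w_bump h.+1 sQ; rewrite -/g => Hw.
    apply: (@le_trans _ _ ((phi Q / s Q) `^ p * (K * g * s Q))).
      by rewrite ler_wpM2l ?powR_ge0// ler_pM2r.
    have Kgs : 0 <= K * g * s Q.
      rewrite mulr_ge0// mulr_ge0// gam_ge0// divr_ge0//.
      by apply: le_trans (stopped_mass_le h.+1 Q t0); exact: stopped_mass_ge0.
    have -> : (1 + C0) `^ p * K * ((phi Q / m) `^ p * (s Q * g)) =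
      (1 + C0) `^ p * (phi Q / m) `^ p * (K * g * s Q) by ring.
    by rewrite ler_wpM2r.
  rewrite [(2 * A) `^ p]powRM//.
  have w0 : 0 <= (2 * t) `^ p * w Q by rewrite mulr_ge0 ?powR_ge0.
  have CK : 0 <= C * K by rewrite !mulr_ge0 ?powR_ge0// invr_ge0 ltW.
  have k2 : 0 <= 2 `^ p :> R := powR_ge0 _ _.
  apply: (@le_trans _ _ (2 `^ p * (C * K * (F Q - persp p (phi Q) m))));
    last first.
    by rewrite -(mulrA _ C K) -(mulrA (2 `^ p)) lerDr.
  rewrite -(mulrA _ C K) -!(mulrA (2 `^ p)) -mulrDr ler_wpM2l//.
  by have := ler_wpM2l CK HS; move: key; lra.
have /= := persp_superadd h t t Q.
set m := bell_mass h.+1 t Q; set M := \sum_b bell_mass h t (child Q b).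
set S := \sum_b persp p (phi (child Q b)) (bell_mass h t (child Q b)).
move=> HS; apply: le_trans (sums _ t0) _.
rewrite lerD2l ler_wpM2l// lerB// -/S; apply: le_trans HS.
rewrite lerDl mulr_ge0//; first by rewrite mulr_ge0 ?powR_ge0// ltW.
rewrite subr_ge0 /M /m; apply: le_trans (sum_bell_mass _ _ _) _.
by rewrite /bell_mass /= -/A ltNge At.
Qed.

Theorem bellman_bound h Q :
  max_integral (fun v => v `^ p) w (fun Q => phi Q / leb Q) h 0 Q <=
  2 `^ p * ((1 + C0) `^ p / (p - 1)) * K * F Q.
Proof.
have := bellman_step h Q (lexx 0); rewrite mulr0 powR0 ?gt_eqF// mul0r add0r.
move=> /le_trans; apply; rewrite ler_wpM2l// ?gerBl ?mulr_ge0 ?powR_ge0//.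
- by rewrite invr_ge0 ltW.
- by rewrite invr_ge0 powR_ge0.
Qed.

End bellman.
End stopping.
End cells.

(** * The concave function built from eps *)

Section entropy_primitive.
Context {R : realType}.
Local Notation mu := (@lebesgue_measure R).
Context (gam : R -> R) (c : R).
Hypotheses (gam_ge0 : forall x, 0 <= gam x)
  (gam_noninc : forall x y, x <= y -> gam y <= gam x)
  (gam_int : (\int[mu]_(x in `[0%R, +oo[) (gam x)%:E <= c%:E)%E).

Definition primitive (x : R) := fine (\int[mu]_(t in `[0%R, x]) (gam t)%:E).

Lemma measurable_noninc D : measurable_fun D gam.
Proof.
apply: measurable_funTS.
have -> : gam = -%R \o (fun x => - gam x) by apply/funext => x /=; rewrite opprK.
apply: measurableT_comp => //; apply: nondecreasing_measurable => // x y xy.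
by rewrite lerN2 gam_noninc.
Qed.

Let mgam D : measurable_fun D (EFin \o gam).
Proof. by apply/measurable_EFinP; exact: measurable_noninc. Qed.

Lemma primitive_le x : (\int[mu]_(t in `[0%R, x]) (gam t)%:E <= c%:E)%E.
Proof.
apply: le_trans gam_int; apply: ge0_subset_integral => //.
- exact: mgam.
- by move=> t _; rewrite lee_fin.
- by apply: subset_itvl; rewrite bnd_simp.
Qed.

Let primitive_fin x : (\int[mu]_(t in `[0%R, x]) (gam t)%:E \is a fin_num)%E.
Proof.
rewrite ge0_fin_numE ?integral_ge0//; last by move=> t _; rewrite lee_fin.
by apply: le_lt_trans (primitive_le x) _; rewrite ltry.
Qed.

Lemma primitive_bound x : primitive x <= c.
Proof. by rewrite -lee_fin fineK// primitive_le. Qed.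

Lemma primitive0 : primitive 0 = 0.
Proof. by rewrite /primitive set_itv1 integral_set1. Qed.

Let primitiveB a b : 0 <= a -> a <= b ->
  ((primitive b)%:E = (primitive a)%:E + \int[mu]_(t in `]a, b]) (gam t)%:E)%E.
Proof.
move=> a0 ab; rewrite !fineK//.
rewrite (@itv_bndbnd_setU _ _ (BLeft 0) (BRight a) (BRight b)) ?bnd_simp//.
rewrite ge0_integral_setU//=.
- exact: mgam.
- by move=> t _; rewrite lee_fin.
- apply/disj_setPS => t [/=]; rewrite !in_itv/= => /andP[_ ta] /andP[].
  by rewrite ltNge ta.
Qed.

Let itv_int a b (k : R) : a <= b ->
  (\int[mu]_(t in `]a, b]) k%:E = (k * (b - a))%:E)%E.
Proof.
move=> ab; rewrite integral_cst//= lebesgue_measure_itv/= lte_fin.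
case: ltP => [_|ba]; first by rewrite -EFinB EFinM.
have -> : b = a by apply/le_anti; rewrite ab ba.
by rewrite subrr mulr0 mule0.
Qed.

(** A nonincreasing function is a supergradient of its primitive at every point,
    jumps included: compare [gam] with the constant [gam x] between [x] and [y]. *)
Lemma primitive_supergradient x y : 0 <= x -> 0 <= y ->
  primitive y <= primitive x + gam x * (y - x).
Proof.
move=> x0 y0; rewrite -lee_fin; case: (leP x y) => xy.
  rewrite EFinD (primitiveB x0 xy) leeD2l// -itv_int//.
  apply: ge0_le_integral => //.
  - by move=> t _; rewrite lee_fin.
  - exact: mgam.
  - move=> t /=; rewrite in_itv/= => /andP[xt _].
    by rewrite lee_fin gam_noninc// ltW.
have yx := ltW xy.
rewrite EFinD (primitiveB y0 yx) -addeA leeDl//.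
have -> : gam x * (y - x) = - (gam x * (x - y)) by ring.
rewrite EFinN sube_ge0//.
rewrite -itv_int//; apply: ge0_le_integral => //.
- by move=> t _; rewrite lee_fin.
- exact: mgam.
- move=> t /=; rewrite in_itv/= => /andP[_ tx].
  by rewrite lee_fin gam_noninc.
Qed.

End entropy_primitive.

Section entropy_weight.
Context {R : realType} (eps : R -> R) (delta : R).
Local Notation mu := (@lebesgue_measure R).
Hypotheses (eps_nd : {in `[1, +oo[ &, {homo eps : s t / s <= t}})
  (delta0 : 0 < delta) (eps1 : delta <= eps 1)
  (eps_int : (\int[mu]_(t in `[1%R, +oo[) ((eps t * t)^-1)%:E = 1)%E).

(** Freezing the argument at [1] extends [1 / (r eps(r))] to a nonincreasing
    function on the line; only on [[0, 1]] does its integral depend on the lower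
    bound of [eps]. *)
Definition entropy_weight (u : R) := (Num.max 1 u * eps (Num.max 1 u))^-1.

Lemma eps_ge t : 1 <= t -> delta <= eps t.
Proof.
by move=> t1; apply: le_trans eps1 _; apply: eps_nd => //; rewrite in_itv/= andbT.
Qed.

Lemma eps_gt0 t : 1 <= t -> 0 < eps t.
Proof. by move=> t1; apply: lt_le_trans delta0 (eps_ge t1). Qed.

Lemma entropy_product_le s t : 1 <= s -> s <= t -> s * eps s <= t * eps t.
Proof.
move=> s1 st; have t1 := le_trans s1 st.
rewrite ler_pM ?(ltW (eps_gt0 _))// ?(le_trans ler01)//.
by apply: eps_nd => //; rewrite in_itv/= andbT.
Qed.

Let max1 (u : R) : 1 <= Num.max 1 u. Proof. by rewrite le_max lexx. Qed.

Lemma entropy_weight_gt0 u : 0 < entropy_weight u.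
Proof.
by rewrite invr_gt0 mulr_gt0 ?eps_gt0// (lt_le_trans ltr01).
Qed.

Lemma entropy_weight_noninc u v : u <= v -> entropy_weight v <= entropy_weight u.
Proof.
move=> uv; rewrite /entropy_weight lef_pV2 ?posrE.
- by apply: entropy_product_le => //; rewrite ge_max !le_max lexx/= uv orbT.
- by rewrite mulr_gt0 ?eps_gt0// (lt_le_trans ltr01).
- by rewrite mulr_gt0 ?eps_gt0// (lt_le_trans ltr01).
Qed.

Lemma entropy_weight_int :
  (\int[mu]_(u in `[0%R, +oo[) (entropy_weight u)%:E <= (delta^-1 + 1)%:E)%E.
Proof.
have m D : measurable_fun D (EFin \o entropy_weight).
  by apply/measurable_EFinP; exact: measurable_noninc entropy_weight_noninc _.
have nn t : (0 <= (entropy_weight t)%:E)%E.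
  by rewrite lee_fin ltW// entropy_weight_gt0.
rewrite (@itv_bndbnd_setU _ _ (BLeft 0) (BLeft 1) +oo%O) ?bnd_simp//.
rewrite ge0_integral_setU//=; [|exact: m|]; last first.
  apply/disj_setPS => t [/=]; rewrite !in_itv/= => /andP[_ t1].
  by rewrite andbT leNgt t1.
rewrite EFinD leeD//.
  apply: (@le_trans _ _ (\int[mu]_(t in `[0%R, 1%R[) (delta^-1)%:E)%E).
    apply: ge0_le_integral => //=; first exact: m.
    move=> t; rewrite in_itv/= => /andP[_ t1]; rewrite lee_fin /entropy_weight.
    rewrite max_l ?(ltW t1)// mul1r lef_pV2 ?posrE//.
    exact: eps_gt0.
  by rewrite integral_cst//= lebesgue_measure_itv/= lte_fin ltr01 sube0 mule1.
rewrite -eps_int le_eqVlt; apply/orP; left; apply/eqP; apply: eq_integral => t.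
rewrite inE/= in_itv/= andbT => t1; rewrite /entropy_weight max_r//.
by rewrite mulrC.
Qed.

End entropy_weight.

(** * Lower integrals, densities and lower limits *)

Section lower_integral.
Local Open Scope ereal_scope.
Context d (T : measurableType d) (R : realType) (mu : {measure set T -> \bar R}).

(** The integral of a nonnegative function, measurable or not, is the supremum of
    those of the simple functions below it.  This is applied to the maximal
    function, a supremum over an uncountable family of cubes. *)
Lemma le_lower_integral (D : set T) (f g : T -> \bar R) :
  (forall x, D x -> 0 <= f x) -> (forall x, D x -> f x <= g x) ->
  \int[mu]_(x in D) f x <= \int[mu]_(x in D) g x.
Proof.
move=> f0 fg; have g0 x : D x -> 0 <= g x.
  by move=> Dx; rewrite (le_trans (f0 _ Dx))// fg.
rewrite !ge0_integralE//; apply: ereal_sup_le => _ [h /= hf <-].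
exists h => // x.
by apply: le_trans (hf x) _; exact: lee_restrict.
Qed.

Import HBNNSimple.

(** Both sides are limits along an increasing sequence of simple functions, and
    they agree on indicator functions. *)
Lemma ge0_integral_density (nu : {measure set T -> \bar R}) (s : T -> R)
    (D : set T) (f : T -> \bar R) :
  measurable_fun setT s -> (forall x, (0 <= s x)%R) ->
  (forall A, measurable A -> nu A = \int[mu]_(x in A) (s x)%:E) ->
  measurable D -> measurable_fun setT f -> (forall x, 0 <= f x) ->
  \int[nu]_(x in D) f x = \int[mu]_(x in D) (f x * (s x)%:E).
Proof.
move=> ms s0 nus mD mf f0.
have mse : measurable_fun setT (EFin \o s) by exact/measurable_EFinP.
pose h := nnsfun_approx measurableT mf.
have fE x : f x = limn (fun n => (h n x)%:E).
  by apply/esym/cvg_lim => //; exact: cvg_nnsfun_approx.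
have nd x m n : (m <= n)%N -> (h m x <= h n x)%R.
  by move=> mn; exact/lefP/nd_nnsfun_approx.
have -> : \int[nu]_(x in D) f x = limn (fun n => \int[nu]_(x in D) (h n x)%:E).
  under eq_integral do rewrite fE.
  apply: monotone_convergence => //.
  - by move=> n; apply/measurable_EFinP; exact: measurable_funTS.
  - by move=> n x _; rewrite lee_fin.
  - by move=> x _ m n mn; rewrite lee_fin nd.
have -> : \int[mu]_(x in D) (f x * (s x)%:E) =
    limn (fun n => \int[mu]_(x in D) ((h n x)%:E * (s x)%:E)).
  rewrite -monotone_convergence//.
  - apply: eq_integral => x _; apply/esym/cvg_lim => //; apply: cvgeZr => //.
    exact: cvg_nnsfun_approx.
  - move=> n; apply: emeasurable_funM; last exact: measurable_funTS.
    by apply/measurable_EFinP; exact: measurable_funTS.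
  - by move=> n x _; rewrite mule_ge0 ?lee_fin.
  - by move=> x _ m n mn; rewrite lee_wpmul2r ?lee_fin ?nd.
congr (limn _); apply/funext => n.
have mind r : measurable_fun D (fun x => (r * \1_(h n @^-1` [set r]) x)%:E).
  by apply/measurable_EFinP/measurable_funTS; exact: measurable_funM.
under eq_integral do rewrite fimfunE -fsumEFin//.
rewrite ge0_integral_fsum//; last by move=> r x _; exact: nnfun_muleindic_ge0.
under [RHS]eq_integral => x _.
  rewrite fimfunE -fsumEFin// ge0_mule_fsuml; last first.
    by move=> r; exact: nnfun_muleindic_ge0.
  over.
rewrite ge0_integral_fsum//; last 2 first.
- by move=> r; apply: emeasurable_funM => //; exact: measurable_funTS.
- by move=> r x _; rewrite mule_ge0 ?lee_fin// -lee_fin nnfun_muleindic_ge0.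
apply: eq_fsbigr => r; rewrite inE => -[t _ <-].
set c := h n t; set A := h n @^-1` [set c].
have mA : measurable A by exact: measurable_funPTI.
under eq_integral do rewrite EFinM.
rewrite ge0_integralZl//; last 2 first.
- by apply/measurable_EFinP/measurable_funTS.
- by rewrite lee_fin.
under [RHS]eq_integral do rewrite EFinM -muleA.
rewrite ge0_integralZl//; last 3 first.
- apply: emeasurable_funM; last exact: measurable_funTS.
  by apply/measurable_EFinP/measurable_funTS.
- by move=> x _; rewrite mule_ge0 ?lee_fin.
- by rewrite lee_fin.
congr (_ * _); rewrite integral_indic// nus//; last exact: measurableI.
rewrite setIC integral_mkcondr; apply: eq_integral => x _.
by rewrite /patch indicE; case: (x \in A); rewrite ?mul1e ?mul0e.
Qed.

End lower_integral.

Section limn_einf_bounds.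
Context {R : realType}.
Local Open Scope ereal_scope.
Implicit Types (u : (\bar R)^nat) (c : \bar R).

Lemma limn_einf_ge u c : (\forall n \near \oo, c <= u n) -> c <= limn_einf u.
Proof.
move=> [N _ cu]; rewrite limn_einf_lim (cvg_lim _ (@cvg_einfs_sup _ u))//.
apply: (@le_trans _ _ (einfs u N)); last by apply: ereal_sup_ubound; exists N.
by apply: le_ereal_inf_tmp => _ [n /= Nn <-]; exact: cu.
Qed.

Lemma limn_einf_le u c : (forall n, u n <= c) -> limn_einf u <= c.
Proof.
move=> uc; rewrite limn_einf_lim (cvg_lim _ (@cvg_einfs_sup _ u))//.
apply: ge_ereal_sup => _ [n _ <-]; apply: le_trans (uc n).
by apply: ereal_inf_lbound; exists n => /=.
Qed.

End limn_einf_bounds.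

(** * Dyadic cubes and dyadic maximal functions *)

Section dyadic_cubes.
Context {R : realType} {d : nat}.
Local Notation T := 'rV[R]_d.
Local Notation cubeT := ('rV[R]_d * {posnum R})%type.
Local Notation bits := {ffun 'I_d -> bool}.

(** Cubes are carried with a side of positive type, so that volumes do not vanish
    at any node of the tree. *)
Definition box (Q : cubeT) : set T := cube Q.1 Q.2%:num.

Definition subcube (Q : cubeT) (b : bits) : cubeT :=
  (\row_i (Q.1 ord0 i + (Q.2%:num / 2) * (b i)%:R), (Q.2%:num / 2)%:pos).

Lemma boxP Q x : box Q x <->
  forall i, Q.1 ord0 i <= x ord0 i < Q.1 ord0 i + Q.2%:num.
Proof. by split=> h i; have := h i; rewrite in_itv. Qed.

Lemma box_cubes Q : cubes (box Q).
Proof. by exists Q.2%:num => //; exists Q.1. Qed.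

Lemma measurable_cube (a : T) l : measurable (cube a l).
Proof.
apply: (measurable_box_rV (A := fun i => `[a ord0 i, a ord0 i + l[%classic)) => i.
exact: measurable_itv.
Qed.

Lemma measurable_box Q : measurable (box Q).
Proof. exact: measurable_cube. Qed.

(** Which child of [Q] contains [x]. *)
Definition bits_of (Q : cubeT) (x : T) : bits :=
  [ffun i => Q.1 ord0 i + Q.2%:num / 2 <= x ord0 i].

Lemma box_subcubeP Q b x : box (subcube Q b) x <-> box Q x /\ b = bits_of Q x.
Proof.
have h0 : 0 < Q.2%:num / 2 by [].
have hh : Q.2%:num = Q.2%:num / 2 + Q.2%:num / 2 by rewrite -splitr.
rewrite !boxP; split => [H|[H ->] i]; last first.
  have := H i; rewrite mxE ffunE; move: (Q.1 _ _) (x _ _) => a y; simpl.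
  move: hh h0; set h := Q.2%:num / 2 => hh h0; rewrite hh.
  by case: (leP (a + h) y) => ? /andP[? ?]; rewrite ?mulr1 ?mulr0;
    apply/andP; split; lra.
split=> [i|].
  have := H i; rewrite mxE; move: (Q.1 _ _) (x _ _) => a y; simpl.
  move: hh h0; set h := Q.2%:num / 2 => hh h0; rewrite hh.
  by case: (b i) => /andP[]; rewrite ?mulr1 ?mulr0 => ? ?; apply/andP; split; lra.
apply/ffunP => i; have := H i; rewrite mxE ffunE.
move: (Q.1 _ _) (x _ _) => a y; simpl.
move: hh h0; set h := Q.2%:num / 2 => hh h0.
by case: (b i) => /andP[]; rewrite ?mulr1 ?mulr0 => ? ?; case: leP => //; lra.
Qed.

Lemma subcube_sub Q b : box (subcube Q b) `<=` box Q.
Proof. by move=> x /box_subcubeP[]. Qed.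

Lemma box_subcube_bits_of Q x : box Q x -> box (subcube Q (bits_of Q x)) x.
Proof. by move=> Qx; apply/box_subcubeP. Qed.

Lemma box_bigsetU Q : box Q = \big[setU/set0]_(b : bits) box (subcube Q b).
Proof.
rewrite -bigcup_seq; apply/seteqP; split => [x Qx|x [b _ /subcube_sub//]].
by exists (bits_of Q x); [rewrite /= mem_index_enum|exact: box_subcube_bits_of].
Qed.

Lemma trivIset_subcube Q D : trivIset D (fun b : bits => box (subcube Q b)).
Proof.
by move=> b c _ _ [x [/box_subcubeP[_ ->] /box_subcubeP[_ ->]]].
Qed.

Lemma integral_box (m : {measure set T -> \bar R}) (f : T -> \bar R) Q :
  measurable_fun setT f -> (forall x, (0 <= f x)%E) ->
  (\int[m]_(x in box Q) f x =
   \sum_(b : bits) \int[m]_(x in box (subcube Q b)) f x)%E.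
Proof.
move=> mf f0; rewrite box_bigsetU ge0_integral_bigsetU//.
- by move=> b; exact: measurable_box.
- exact: index_enum_uniq.
- exact: trivIset_subcube.
- exact: measurable_funTS.
Qed.

Lemma additive_integral_box (m : {measure set T -> \bar R}) (f : T -> \bar R) :
  measurable_fun setT f -> (forall x, (0 <= f x)%E) ->
  (forall Q, (\int[m]_(x in box Q) f x < +oo)%E) ->
  tree_additive subcube (fun Q => fine (\int[m]_(x in box Q) f x)).
Proof.
move=> mf f0 foo Q; rewrite integral_box// -sum_fine// => b _.
by rewrite ge0_fin_numE// integral_ge0.
Qed.

Lemma measure_box_integral (m : {measure set T -> \bar R}) Q :
  m (box Q) = (\int[m]_(x in box Q) (cst 1) x)%E.
Proof. by rewrite integral_cst ?mul1e//; exact: measurable_box. Qed.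

Lemma additive_measure_box (m : {measure set T -> \bar R}) :
  (forall Q, (m (box Q) < +oo)%E) ->
  tree_additive subcube (fun Q => fine (m (box Q))).
Proof.
move=> moo Q; under eq_bigr do rewrite measure_box_integral.
rewrite measure_box_integral (additive_integral_box _ _ _ Q)//.
by move=> P; rewrite -measure_box_integral.
Qed.

(** The maximum of [v] and of the averages of the descendants of [Q], of
    generation less than [h], that contain [x].  The sum has one nonzero term
    ([dyadic_maxS]); this form makes measurability immediate. *)
Fixpoint dyadic_max (avg : cubeT -> R) h (v : R) Q (x : T) : R :=
  if h is h'.+1
  then \sum_(b : bits) \1_(box (subcube Q b)) x *
         dyadic_max avg h' (Num.max v (avg Q)) (subcube Q b) x
  else v.

Section dyadic_max.
Context (avg : cubeT -> R).

Lemma dyadic_maxS h v Q x : box Q x -> dyadic_max avg h.+1 v Q x =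
  dyadic_max avg h (Num.max v (avg Q)) (subcube Q (bits_of Q x)) x.
Proof.
move=> Qx /=; rewrite (bigD1 (bits_of Q x))//= big1 ?addr0 => [|b bx].
  by rewrite indicE mem_set ?mul1r//; exact: box_subcube_bits_of.
rewrite indicE memNset ?mul0r// => /box_subcubeP[_ E].
by move: bx; rewrite E eqxx.
Qed.

Lemma dyadic_max_ge0 h v Q x : 0 <= v -> 0 <= dyadic_max avg h v Q x.
Proof.
elim: h v Q => //= h IH v Q v0; apply: sumr_ge0 => b _.
by rewrite mulr_ge0// IH// le_max v0.
Qed.

Lemma measurable_dyadic_max h v Q : measurable_fun setT (dyadic_max avg h v Q).
Proof.
elim: h v Q => [|h IH] v Q /=; first exact: measurable_cst.
apply: measurable_sum => b; apply: measurable_funM => //.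
by apply: measurable_indic; exact: measurable_box.
Qed.

Lemma dyadic_max_ge h v Q x : box Q x -> v <= dyadic_max avg h v Q x.
Proof.
elim: h v Q => // h IH v Q Qx; rewrite dyadic_maxS//.
apply: le_trans (IH _ _ (box_subcube_bits_of Qx)).
by rewrite le_max lexx.
Qed.

(** Only averages over subcubes of [A] enter, so that [M] can be the maximal
    function of a weight restricted to [A]. *)
Lemma dyadic_max_le (A : set T) (M : T -> \bar R) h v Q x :
  (forall P, box P `<=` A -> forall y, box P y -> ((avg P)%:E <= M y)%E) ->
  box Q `<=` A -> box Q x -> (v%:E <= M x)%E ->
  ((dyadic_max avg h v Q x)%:E <= M x)%E.
Proof.
move=> avgM; elim: h v Q => // h IH v Q QA Qx vM; rewrite dyadic_maxS//.
apply: IH.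
- exact: subset_trans (@subcube_sub _ _) QA.
- exact: box_subcube_bits_of.
- by rewrite EFin_max ge_max vM/= (avgM Q).
Qed.

Lemma integral_dyadic_max (m : {measure set T -> \bar R}) (H : R -> R) h v Q :
  (forall P, (m (box P) < +oo)%E) -> measurable_fun setT H ->
  (forall y, 0 <= y -> 0 <= H y) -> 0 <= v ->
  (\int[m]_(x in box Q) (H (dyadic_max avg h v Q x))%:E =
   (max_integral subcube H (fun P => fine (m (box P))) avg h v Q)%:E)%E.
Proof.
move=> moo mH H0; elim: h v Q => [|h IH] v Q v0 /=.
  rewrite integral_cst; last exact: measurable_box.
  by rewrite EFinM fineK// ge0_fin_numE.
have u0 : 0 <= Num.max v (avg Q) by rewrite le_max v0.
rewrite integral_box; last 2 first.
- apply/measurable_EFinP; apply: measurableT_comp => //.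
  exact: (measurable_dyadic_max h.+1 v Q).
- by move=> x; rewrite lee_fin H0//; exact: (dyadic_max_ge0 h.+1 Q x v0).
rewrite -sumEFin; apply: eq_bigr => b _; rewrite -IH//.
apply: eq_integral => x; rewrite inE => /box_subcubeP[Qx bE].
by have /= -> := dyadic_maxS h v Qx; rewrite -bE.
Qed.

Fixpoint descendant k (Q P : cubeT) : Prop :=
  if k is k'.+1 then exists b, descendant k' (subcube Q b) P else P = Q.

Lemma descendant_sub k Q P : descendant k Q P -> box P `<=` box Q.
Proof.
elim: k Q => [Q ->//|k IH Q [b /IH]].
by move=> /subset_trans; apply; exact: subcube_sub.
Qed.

Lemma dyadic_max_descendant k h v Q P x : (k < h)%N -> descendant k Q P ->
  box P x -> avg P <= dyadic_max avg h v Q x.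
Proof.
elim: k h v Q => [|k IH] [//|h] v Q kh.
  move=> -> Qx; rewrite dyadic_maxS//.
  apply: le_trans (dyadic_max_ge _ _ (box_subcube_bits_of Qx)).
  by rewrite le_max lexx orbT.
move=> [b bP] Px; have /box_subcubeP[Qx bE] := descendant_sub bP Px.
by rewrite dyadic_maxS// -bE; exact: IH.
Qed.

(** The corner coordinates of [P] are recorded because the covering argument
    needs to know on which lattice the next dyadic point lies. *)
Lemma descendant_exists k Q x : box Q x -> exists P, [/\ descendant k Q P,
  box P x, P.2%:num = Q.2%:num / 2 ^+ k &
  forall i, exists j : nat, P.1 ord0 i = Q.1 ord0 i + P.2%:num * j%:R].
Proof.
elim: k Q => [|k IH] Q Qx.
  exists Q; split=> //; first by rewrite expr0 divr1.
  by move=> i; exists 0; rewrite mulr0 addr0.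
have [P [bP Px P2 P1]] := IH _ (box_subcube_bits_of Qx).
exists P; split => //; first by exists (bits_of Q x).
  by rewrite P2 /= exprS invfM mulrA.
move=> i; have [j ->] := P1 i.
exists ((bits_of Q x i) * 2 ^ k + j)%N.
rewrite mxE P2 /= natrD natrM natrX mulrDr addrA.
congr (_ + _ + _); field; rewrite expf_neq0//.
Qed.

End dyadic_max.
End dyadic_cubes.

(** * Covering a cube by dyadic cubes of shifted roots *)

Section third_shift.
Context {R : realType}.

(** The lattices of step [3 u] based at [e] and at [e - 2^k u] are at distance at
    least [u] from each other, as [3] does not divide [2^k]; an open interval of
    length at most [u] cannot meet both. *)
Lemma third_shift (u e a l : R) k : 0 < u -> l <= u -> exists c : bool,
  forall j : nat, ~~ (a < e - c%:R * (2 ^+ k * u) + 3 * u * j%:R < a + l).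
Proof.
move=> u0 lu; apply: contrapT => H.
have E (c : bool) : exists j : nat,
    a < e - c%:R * (2 ^+ k * u) + 3 * u * j%:R < a + l.
  apply: contrapT => Hc; apply: H; exists c => j; apply/negP => Hj.
  by apply: Hc; exists j.
have [j0 /andP[A0 B0]] := E false; have [j1 /andP[A1 B1]] := E true.
move: A0 B0 A1 B1; rewrite mul0r subr0 mul1r => A0 B0 A1 B1.
have L1 : (3 * j0 + 2 ^ k)%N%:R < (3 * j1 + 1)%N%:R :> R.
  rewrite (natrD _ (3 * j0) (2 ^ k)) (natrD _ (3 * j1) 1) !(natrM _ 3) natrX.
  by rewrite -(ltr_pM2r u0) !mulrDl mul1r; move: (2 ^+ k * u) A1 B1 => z; lra.
have L2 : (3 * j1)%N%:R < (3 * j0 + 2 ^ k + 1)%N%:R :> R.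
  rewrite (natrD _ (3 * j0 + 2 ^ k) 1) (natrD _ (3 * j0) (2 ^ k)) !(natrM _ 3).
  rewrite natrX -(ltr_pM2r u0) !mulrDl mul1r.
  by move: (2 ^+ k * u) A1 B1 => z; lra.
move: L1 L2; rewrite !ltr_nat => L1 L2.
have E3 : (3 * j0 + 2 ^ k = 3 * j1)%N by lia.
have : (3 %| 2 ^ k)%N.
  by rewrite -(@dvdn_addr (3 * j0))// ?E3 dvdn_mulr.
by rewrite Euclid_dvdX.
Qed.

(** The least [k] with [2^n / 2^k < 2 l] also satisfies [l <= 2^n / 2^k]; the
    hypotheses on [n] keep it between [0] and [2 n]. *)
Lemma dyadic_scale (l : R) n : 0 < l -> l <= 2 ^+ n -> 1 < 2 * l * 2 ^+ n ->
  exists2 k, (k <= n.*2)%N & l <= 2 ^+ n / 2 ^+ k < 2 * l.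
Proof.
move=> l0 ln nl; have p2 m : 0 < 2 ^+ m :> R by rewrite exprn_gt0.
have ex : exists k, 2 ^+ n < 2 * l * 2 ^+ k.
  by exists n.*2; rewrite -addnn exprD mulrA ltr_pMl.
have [k kP kmin] := ex_minnP ex; exists k.
  by apply: kmin; rewrite -addnn exprD mulrA ltr_pMl.
rewrite ltr_pdivrMr// kP andbT; case: k kmin {kP} => [|k] kmin.
  by rewrite expr0 divr1.
rewrite ler_pdivlMr// exprS mulrA (mulrC l) leNgt; apply/negP => /kmin.
by rewrite ltnn.
Qed.

Lemma near_expr2 (r : R) : \forall n \near \oo, r <= 2 ^+ n.
Proof.
have := nbhs_infty_ger r; apply: filterS => n /le_trans; apply.
by rewrite -natrX ler_nat ltnW// ltn_expl.
Qed.

End third_shift.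

Section covering.
Context {R : realType} {d : nat}.
Local Notation T := 'rV[R]_d.
Local Notation cubeT := ('rV[R]_d * {posnum R})%type.
Local Notation bits := {ffun 'I_d -> bool}.

(** Side [3 * 2^n], and a shift of [2^n], a third of it, in the coordinates
    selected by [c].  All these cubes contain [[-2^n, 2^n)^d]. *)
Definition root_cube (n : nat) (c : bits) : cubeT :=
  (\row_i (- 2 ^+ n - (c i)%:R * 2 ^+ n), (3 * 2 ^+ n)%:pos).

(** In each coordinate choose the shift for which no dyadic point of step [3 u]
    lies inside the side of the given cube, where [l <= u < 2 l]; then the dyadic
    cube of side [3 u] that contains the corner [a] contains everything. *)
Lemma cover_by_descendant (a : T) (l : R) : 0 < l ->
  \forall n \near \oo, exists c k P, [/\ (k < n.*2.+1)%N,
    descendant k (root_cube n c) P, cube a l `<=` box P & P.2%:num <= 6 * l].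
Proof.
move=> l0; near=> n.
have p2 m : 0 < 2 ^+ m :> R by rewrite exprn_gt0.
have ln : l <= 2 ^+ n by near: n; exact: near_expr2.
have nl : 1 < 2 * l * 2 ^+ n.
  have : l^-1 <= 2 ^+ n by near: n; exact: near_expr2.
  rewrite -(ler_pM2l l0) divff ?gt_eqF//; lra.
have an i : - 2 ^+ n <= a ord0 i < 2 ^+ n.
  have : \sum_i `|a ord0 i| + 1 <= 2 ^+ n by near: n; exact: near_expr2.
  rewrite (bigD1 i)//= => H.
  have : 0 <= \sum_(i0 < d | i0 != i) `|a ord0 i0| by exact: sumr_ge0.
  have := ler_norm (a ord0 i); have := ler_norm (- a ord0 i); rewrite normrN.
  by move=> ? ? ?; apply/andP; split; lra.
have [k kn /andP[lu ul]] := dyadic_scale l0 ln nl.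
set u := 2 ^+ n / 2 ^+ k in lu ul.
have u0 : 0 < u by rewrite divr_gt0.
have uE : 2 ^+ k * u = 2 ^+ n by rewrite mulrC divfK ?gt_eqF.
have /choice[c0 Hc0] (i : 'I_d) := third_shift (- 2 ^+ n) (a ord0 i) k u0 lu.
pose c : bits := [ffun i => c0 i].
have ra : box (root_cube n c) a.
  apply/boxP => i; rewrite mxE ffunE /=; have := an i.
  have := p2 n; move: (2 ^+ n) => z z0 /andP[? ?].
  by case: (c0 i); rewrite ?mul1r ?mul0r; apply/andP; split; lra.
have [P [dP Pa P2 P1]] := descendant_exists k ra.
exists c, k, P; split => //.
  move=> x ax; apply/boxP => i.
  have := ax i; rewrite in_itv/= => /andP[ax1 ax2].
  have /boxP/(_ i)/andP[Pa1 Pa2] := Pa.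
  rewrite (le_trans Pa1)//=; apply: lt_le_trans ax2 _.
  have [j Pj] := P1 i.
  have /negP := Hc0 i j.+1; rewrite uE.
  have -> : - 2 ^+ n - (c0 i)%:R * 2 ^+ n + 3 * u * j.+1%:R =
      P.1 ord0 i + P.2%:num.
    rewrite Pj P2 mxE ffunE /= -natr1 /u; field.
    by rewrite expf_neq0.
  by rewrite Pa2 /= => /negP; rewrite -leNgt.
rewrite P2 /= -mulrA -/u; move: ul; lra.
Unshelve. all: by end_near. Qed.

End covering.

(** * The bump condition on dyadic cubes *)

Section weight_cube.
Context {R : realType} {d : nat}.
Local Notation T := 'rV[R]_d.

(** A half-open cube lies in a compact box. *)
Lemma weight_cube_lty (s : weight R d) (a : T) l :
  (weight_measure s (cube a l) < +oo)%E.
Proof.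
pose K : set T :=
  [set x | forall i, `[a ord0 i, a ord0 i + l]%classic (x ord0 i)].
have cK : compact K.
  apply: (@rV_compact R d (fun i => `[a ord0 i, a ord0 i + l]%classic)) => i.
  exact: segment_compact.
have [ms /(_ K cK) Koo] := density_locally_integrable s.
apply: le_lt_trans Koo; rewrite /weight_measure.
under [leRHS]eq_integral do rewrite ger0_norm ?density_ge0//.
apply: ge0_subset_integral.
- exact: measurable_cube.
- apply: (measurable_box_rV
    (A := fun i => `[a ord0 i, a ord0 i + l]%classic)) => i.
  exact: measurable_itv.
- by apply/measurable_EFinP; exact: measurable_funTS.
- by move=> x _; rewrite lee_fin density_ge0.
- move=> x ax i /=; have := ax i; rewrite !in_itv/= => /andP[-> /ltW ->//].
Qed.

End weight_cube.

Section cube_averages.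
Context {R : realType} {d : nat}.
Local Notation T := 'rV[R]_d.
Local Notation cubeT := ('rV[R]_d * {posnum R})%type.
Local Notation mu := (lebesgue_rV d).

Definition vol (P : cubeT) : R := P.2%:num ^+ d.
Definition mass (s : weight R d) (P : cubeT) : R :=
  fine (weight_measure s (box P)).

Lemma volE P : lebesgue_rV d (box P) = (vol P)%:E.
Proof. exact: lebesgue_cube. Qed.

Lemma vol_gt0 P : 0 < vol P.
Proof. by rewrite exprn_gt0. Qed.

Lemma massE s P : weight_measure s (box P) = (mass s P)%:E.
Proof. by rewrite fineK// ge0_fin_numE// weight_cube_lty. Qed.

Lemma mass_ge0 s P : 0 <= mass s P.
Proof. by rewrite fine_ge0. Qed.

Lemma vol_add : tree_additive subcube vol.
Proof.
have H Q : vol Q = fine (lebesgue_rV d (box Q)) by rewrite volE.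
move=> Q; rewrite H (additive_measure_box _ Q) => [|P]; last first.
  by rewrite [X in (X < _)%E]volE ltry.
by apply: eq_bigr => b _; rewrite H.
Qed.

Lemma mass_add s : tree_additive subcube (mass s).
Proof. by apply: additive_measure_box => P; exact: weight_cube_lty. Qed.

Lemma averageE (s : weight R d) P : average s (box P) = (mass s P / vol P)%:E.
Proof.
rewrite /average volE inver (gt_eqF (vol_gt0 P)).
by rewrite [X in (_ * X)%E](massE s P) -EFinM mulrC.
Qed.

Lemma average_ge0 (g : T -> R) Q : (forall x, 0 <= g x) -> (0 <= average g Q)%E.
Proof.
move=> g0; rewrite /average mule_ge0//; last first.
  by apply: integral_ge0 => x _; rewrite lee_fin.
by rewrite inve_ge0.
Qed.

Lemma maximal_ge0 (g : T -> R) x : (0 <= maximal g x)%E.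
Proof.
apply: (@le_trans _ _ (average (fun y => `|g y|) (box (x, 1%:pos)))).
  exact: average_ge0.
apply: ereal_sup_ubound; exists (box (x, 1%:pos)) => //; split.
  exact: box_cubes.
by apply/boxP => i /=; rewrite lexx ltrDl ltr01.
Qed.

Lemma average_le_maximal (s : weight R d) P Q x : box P `<=` box Q -> box P x ->
  ((mass s P / vol P)%:E <= maximal (s \* \1_(box Q))%R x)%E.
Proof.
move=> PQ Px; rewrite -averageE; apply: ereal_sup_ubound.
exists (box P); first by split => //; exact: box_cubes.
rewrite /average; congr (_ * _)%E; apply: eq_integral => y; rewrite inE => /PQ Qy.
by rewrite /= indicE mem_set// mulr1 ger0_norm// density_ge0.
Qed.

End cube_averages.

Section bump_condition.
Context {R : realType} {d : nat} (s w : weight R d) (p delta K : R).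
Context (eps : R -> R).
Local Notation cubeT := ('rV[R]_d * {posnum R})%type.
Local Notation mu := (lebesgue_rV d).
Hypotheses (p1 : 1 < p) (delta0 : 0 < delta)
  (eps_nd : {in `[1, +oo[ &, {homo eps : s t / s <= t}}) (eps1 : delta <= eps 1).

Let M Q := (\int[mu]_(x in box Q) maximal (s \* \1_(box Q))%R x)%E.
Local Notation U := (max_integral subcube idfun vol (fun P => mass s P / vol P)).

(** The dyadic maximal function of the weight inside [Q] is dominated by
    [maximal (s 1_Q)]; together with [stopped_mass_le] it bounds the stopped mass
    by [2 rho(Q) s(Q)]. *)
Lemma max_integral_le_maximal h (Q : cubeT) : ((U h 0 Q)%:E <= M Q)%E.
Proof.
have E (P : cubeT) : vol P = fine (mu (box P)) by rewrite volE.
rewrite (_ : U h 0 Q = max_integral subcube idfun (fun P => fine (mu (box P)))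
  (fun P => mass s P / vol P) h 0 Q); last first.
  by congr (max_integral _ _ _ _ _ _ _); apply/funext => P; rewrite E.
rewrite -integral_dyadic_max//; last 2 first.
- by move=> P; rewrite [X in (X < _)%E]volE ltry.
- exact: measurable_id.
apply: le_lower_integral => x Qx.
  by rewrite lee_fin dyadic_max_ge0.
apply: (@dyadic_max_le _ _ _ (box Q)) => //; last exact: maximal_ge0.
by move=> P PQ y Py; exact: average_le_maximal.
Qed.

Lemma mass_le_maximal Q : ((mass s Q)%:E <= M Q)%E.
Proof.
apply: (@le_trans _ _ (\int[mu]_(x in box Q) (mass s Q / vol Q)%:E)%E);
  last first.
  apply: le_lower_integral => x Qx; last exact: average_le_maximal.
  by rewrite lee_fin divr_ge0 ?mass_ge0// ltW// vol_gt0.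
rewrite integral_cst; last exact: measurable_box.
by rewrite [X in (_ * X)%E]volE -EFinM divfK// gt_eqF// vol_gt0.
Qed.

Lemma rho_ge1 Q : 0 < mass s Q -> (1 <= rho s (box Q))%E.
Proof.
move=> s0; rewrite /rho massE inver gt_eqF// lee_pdivlMr// mul1e.
exact: mass_le_maximal.
Qed.

Lemma rho_eps_ge0 Q : (0 <= rho_eps s eps (box Q))%E.
Proof.
rewrite /rho_eps; have := mass_ge0 s Q.
rewrite le_eqVlt => /predU1P[s0|/rho_ge1]; last first.
  case: (rho s _) => // r; rewrite lee_fin => r1; rewrite lee_fin mulr_ge0//.
    exact: le_trans r1.
  by rewrite ltW// (eps_gt0 eps_nd delta0 eps1).
rewrite /rho massE -s0 inver eqxx.
have : (0 <= M Q)%E.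
  by apply: le_trans (mass_le_maximal Q); rewrite lee_fin mass_ge0.
rewrite -/(M Q) le_eqVlt => /predU1P[<-|M0]; first by rewrite mul0e /= mul0r.
by rewrite gt0_muley.
Qed.

Lemma entropy_bump_ge0 : (0 <= entropy_bump s w p eps)%E.
Proof.
have [Q _] : exists Q : cubeT, True by exists (0, 1%:pos).
apply: (@le_trans _ _
  (rho_eps s eps (box Q) * average s (box Q) `^ (p - 1) * average w (box Q))%E).
  apply: mule_ge0; last by apply: average_ge0 => x; exact: density_ge0.
  by rewrite mule_ge0 ?rho_eps_ge0 ?poweR_ge0.
by apply: ereal_sup_ubound; exists (box Q) => //; exact: box_cubes.
Qed.

Hypotheses (K0 : 0 <= K) (bumpK : (entropy_bump s w p eps <= K%:E)%E).

(** The hypothesis on [w] of the Bellman induction.  Since [r |-> r eps(r)] is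
    increasing, [rho] may be replaced by its lower bounds [1] and [U / s].  When
    [rho] is infinite the finiteness of the bump forces [w(Q) = 0]. *)
Lemma entropy_bump_cube h (Q : cubeT) : 0 < mass s Q ->
  mass w Q / vol Q * (mass s Q / vol Q) `^ (p - 1) <=
  K * entropy_weight eps (2 * U h 0 Q / mass s Q / 2).
Proof.
move=> s0; set u := _ / 2.
have -> : u = U h 0 Q / mass s Q by rewrite /u; field; rewrite gt_eqF.
set X := (mass s Q / vol Q) `^ (p - 1); set Y := mass w Q / vol Q.
have X0 : 0 < X by rewrite powR_gt0// divr_gt0// vol_gt0.
have Y0 : 0 <= Y by rewrite divr_ge0 ?mass_ge0// ltW// vol_gt0.
have ew0 : 0 < entropy_weight eps (U h 0 Q / mass s Q).
  exact: entropy_weight_gt0 eps_nd delta0 eps1 _.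
have : (rho_eps s eps (box Q) * X%:E * Y%:E <= K%:E)%E.
  rewrite /X /Y -poweR_EFin -!averageE; apply: le_trans bumpK.
  by apply: ereal_sup_ubound; exists (box Q) => //; exact: box_cubes.
have : ((U h 0 Q / mass s Q)%:E <= rho s (box Q))%E.
  rewrite /rho massE inver gt_eqF// EFinM lee_pmul2r//.
    exact: max_integral_le_maximal.
  by rewrite lte_fin invr_gt0.
have := rho_ge1 s0; rewrite /rho_eps; case: (rho s _) => [r|_ _|//].
  rewrite !lee_fin => r1 Ur H.
  have {}H : r * eps r * (Y * X) <= K by rewrite (mulrC Y) mulrA.
  rewrite /entropy_weight ler_pdivlMr; last by rewrite -invr_gt0.
  have YX0 : 0 <= Y * X by rewrite mulr_ge0// ltW.
  apply: le_trans H; rewrite mulrC ler_wpM2r//.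
  apply: (entropy_product_le eps_nd delta0 eps1); first by rewrite le_max lexx.
  by rewrite ge_max r1.
rewrite gt0_mulye ?lte_fin//; move: Y0; rewrite le_eqVlt => /predU1P[<- _|Y0].
  by rewrite mul0r mulr_ge0// ltW.
by rewrite gt0_mulye ?lte_fin// leye_eq.
Qed.

End bump_condition.

(** * Integrals of f against sigma over dyadic cubes *)

Section weighted_function.
Context {R : realType} {d : nat} (s : weight R d) (p : R) (f : 'rV[R]_d -> R).
Local Notation T := 'rV[R]_d.
Local Notation cubeT := ('rV[R]_d * {posnum R})%type.
Local Notation nu := (weight_measure s).
Hypotheses (p1 : 1 < p) (mf : measurable_fun setT f)
  (f_fin : (\int[nu]_x (`|f x| `^ p)%:E < +oo)%E).

Let p0 : 0 < p. Proof. exact: lt_trans p1. Qed.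

(** [phi(Q)] and [F(Q)] of the Bellman induction. *)
Definition abs_mass (P : cubeT) : R := fine (\int[nu]_(x in box P) `|f x|%:E).
Definition energy (P : cubeT) : R :=
  fine (\int[nu]_(x in box P) (`|f x| `^ p)%:E).

Let mfabs : measurable_fun setT (fun x => `|f x|%:E).
Proof. by apply/measurable_EFinP; exact: measurableT_comp. Qed.

Let mfpow : measurable_fun setT (fun x => (`|f x| `^ p)%:E).
Proof.
apply/measurable_EFinP; apply: (measurableT_comp (measurable_powR p)).
exact: measurableT_comp.
Qed.

Lemma energy_le P :
  (\int[nu]_(x in box P) (`|f x| `^ p)%:E <= \int[nu]_x (`|f x| `^ p)%:E)%E.
Proof.
apply: ge0_subset_integral => //; exact: measurable_box.
Qed.

Lemma energyE P : (\int[nu]_(x in box P) (`|f x| `^ p)%:E = (energy P)%:E)%E.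
Proof.
rewrite fineK// ge0_fin_numE; first exact: le_lt_trans (energy_le P) f_fin.
by apply: integral_ge0 => x _; rewrite lee_fin powR_ge0.
Qed.

(** Pointwise Young-type inequalities, integrated.  They give both the finiteness
    of [abs_mass] and the Jensen inequality between [abs_mass] and [energy]. *)
Lemma young_integral (k c : R) P : 0 <= k -> 0 <= c ->
  (forall a, 0 <= a -> k * a <= a `^ p + c) ->
  (k%:E * \int[nu]_(x in box P) `|f x|%:E <=
   (energy P + c * mass s P)%:E)%E.
Proof.
move=> k0 c0 H; rewrite -ge0_integralZl_EFin//; last 2 first.
- exact: measurable_box.
- exact: measurable_funTS.
apply: (@le_trans _ _ (\int[nu]_(x in box P) ((`|f x| `^ p)%:E + c%:E))%E).
  apply: ge0_le_integral.
  - exact: measurable_box.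
  - by move=> x _; rewrite mule_ge0// lee_fin.
  - by apply: measurable_funeM; exact: measurable_funTS.
  - by apply: emeasurable_funD; exact: measurable_funTS.
  - by move=> x _; rewrite -EFinM -EFinD lee_fin H.
rewrite ge0_integralD//.
- rewrite integral_cst; last exact: measurable_box.
  by rewrite [X in (_ * X)%E](massE s P) energyE.
- exact: measurable_box.
- exact: measurable_funTS.
Qed.

Lemma abs_massE P : (\int[nu]_(x in box P) `|f x|%:E = (abs_mass P)%:E)%E.
Proof.
rewrite fineK// ge0_fin_numE; last by apply: integral_ge0 => x _; rewrite lee_fin.
rewrite -[ltLHS]mul1e; apply: le_lt_trans (ltry (energy P + 1 * mass s P)).
apply: young_integral => // a a0; rewrite mul1r; have [a1|a1] := leP a 1.
  by rewrite (le_trans a1)// lerDr powR_ge0.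
by rewrite (@le_trans _ _ (a `^ p)) ?lerDl// -[leLHS]powRr1// ler_powR// ltW.
Qed.

Lemma abs_mass_ge0 P : 0 <= abs_mass P.
Proof. by rewrite fine_ge0// integral_ge0// => x _; rewrite lee_fin. Qed.

Lemma abs_mass_add : tree_additive subcube abs_mass.
Proof. by apply: additive_integral_box => // P; rewrite abs_massE ltry. Qed.

Lemma energy_add : tree_additive subcube energy.
Proof.
apply: additive_integral_box => // P.
by rewrite energyE ltry.
Qed.

Lemma abs_mass_eq0 P : mass s P = 0 -> abs_mass P = 0.
Proof.
move=> s0; rewrite /abs_mass null_set_integral//.
- exact: measurable_box.
- exact: measurable_funTS.
- by rewrite [LHS](massE s P) s0.
Qed.

Lemma jensen_energy P : persp p (abs_mass P) (mass s P) <= energy P.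
Proof.
have e0 : 0 <= energy P.
  by rewrite fine_ge0// integral_ge0// => x _; rewrite lee_fin powR_ge0.
have := abs_mass_ge0 P; rewrite le_eqVlt => /predU1P[<-|phi0].
  by rewrite /persp powR0 ?gt_eqF// mul0r.
have s0 : 0 < mass s P.
  rewrite lt_def mass_ge0 andbT; apply: contraTneq phi0 => /abs_mass_eq0 ->.
  by rewrite ltxx.
rewrite -persp_tangentE//; set z := _ / _.
have z0 : 0 <= z by rewrite divr_ge0 ?mass_ge0// ltW.
rewrite lerBlDr -lee_fin EFinM -abs_massE; apply: young_integral => //.
- by rewrite mulr_ge0 ?powR_ge0// ltW.
- by rewrite mulr_ge0 ?powR_ge0// subr_ge0 ltW.
- by move=> a a0; rewrite -lerBlDr; exact: powR_tangent.
Qed.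

Lemma integral_weighted A : measurable A ->
  (\int[lebesgue_rV d]_(x in A) (`|(s \* f)%R x|)%:E =
   \int[nu]_(x in A) `|f x|%:E)%E.
Proof.
move=> mA; rewrite (@ge0_integral_density _ _ _ (lebesgue_rV d) nu s)//.
- by apply: eq_integral => x _; rewrite /= normrM (ger0_norm (density_ge0 s x))
    -EFinM mulrC.
- by have [] := density_locally_integrable s.
- exact: density_ge0.
Qed.

(** [6^d] bounds the ratio of the volumes of [P] and of the cube. *)
Lemma average_le_descendant (a : T) (l : R) P : 0 < l -> cube a l `<=` box P ->
  P.2%:num <= 6 * l ->
  (average (fun y : T => `|(s \* f)%R y|%R) (cube a l) <=
   (6 ^+ d * (abs_mass P / vol P))%:E)%E.
Proof.
move=> l0 aP Pl; rewrite /average lebesgue_cube// inver gt_eqF ?exprn_gt0//.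
rewrite lee_pdivrMl ?exprn_gt0// integral_weighted; last exact: measurable_cube.
apply: (@le_trans _ _ (abs_mass P)%:E).
  rewrite -abs_massE; apply: ge0_subset_integral => //.
  - exact: measurable_cube.
  - exact: measurable_box.
  - exact: measurable_funTS.
have -> : ((l ^+ d)%:E * (6 ^+ d * (abs_mass P / vol P))%:E =
    (abs_mass P * ((6 * l) ^+ d / vol P))%:E)%E.
  by rewrite -EFinM exprMn; congr EFin; ring.
rewrite lee_fin ler_peMr ?abs_mass_ge0//.
by rewrite ler_pdivlMr ?vol_gt0// mul1r /vol lerXn2r ?nnegrE// mulr_ge0// ltW.
Qed.

End weighted_function.

(** * The maximal inequality *)

Section constants.
Context {R : realType} (d : nat) (p delta : R).
Local Notation bits := {ffun 'I_d -> bool}.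

Definition dyadic_const : R :=
  2 `^ p * ((1 + 2 * (delta^-1 + 1)) `^ p / (p - 1)).

Definition maximal_const : R := (6 ^+ d) `^ p * #|{: bits}|%:R * dyadic_const.

Hypotheses (p1 : 1 < p) (delta0 : 0 < delta).

Lemma dyadic_const_gt0 : 0 < dyadic_const.
Proof.
rewrite mulr_gt0 ?powR_gt0// divr_gt0 ?powR_gt0 ?subr_gt0//.
by rewrite addr_gt0// mulr_gt0// addr_gt0// invr_gt0.
Qed.

Lemma maximal_const_gt0 : 0 < maximal_const.
Proof.
rewrite mulr_gt0 ?dyadic_const_gt0// mulr_gt0 ?powR_gt0 ?exprn_gt0// ltr0n.
by apply/card_gt0P; exists [ffun=> false].
Qed.

End constants.

Section maximal_bound.
Context {R : realType} {d : nat} (s w : weight R d) (p delta K : R).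
Context (eps : R -> R).
Local Notation T := 'rV[R]_d.
Local Notation cubeT := ('rV[R]_d * {posnum R})%type.
Local Notation bits := {ffun 'I_d -> bool}.
Local Notation nu := (weight_measure s).
Hypotheses (p1 : 1 < p) (delta0 : 0 < delta)
  (eps_nd : {in `[1, +oo[ &, {homo eps : s t / s <= t}}) (eps1 : delta <= eps 1)
  (eps_int :
    (\int[lebesgue_measure]_(t in `[1%R, +oo[) ((eps t * t)^-1)%:E = 1)%E)
  (K0 : 0 <= K) (bumpK : (entropy_bump s w p eps <= K%:E)%E).

Let p0 : 0 < p. Proof. exact: lt_trans p1. Qed.

Section fixed_function.
Context (f : T -> R).
Local Notation dyadic_const := (dyadic_const p delta).
Local Notation maximal_const := (maximal_const d p delta).
Hypotheses (mf : measurable_fun setT f)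
  (f_fin : (\int[nu]_x (`|f x| `^ p)%:E < +oo)%E).
Local Notation phi := (abs_mass s f).
Local Notation W h := (dyadic_max (fun P => phi P / vol P) h 0).

(** The Bellman induction with [gam x] the entropy weight at [x / 2]: the halving
    absorbs the factor [2] in [stopped_mass_le]. *)
Lemma dyadic_bound h (Q : cubeT) :
  (\int[weight_measure w]_(x in box Q) (W h Q x `^ p)%:E <=
   (dyadic_const * K)%:E * \int[nu]_x (`|f x| `^ p)%:E)%E.
Proof.
rewrite (@integral_dyadic_max _ _ _ _ (fun v => v `^ p))//; last 2 first.
- by move=> P; exact: weight_cube_lty.
- by move=> y _; exact: powR_ge0.
apply: (@le_trans _ _ (dyadic_const * K * energy s p f Q)%:E); last first.
  rewrite EFinM lee_wpmul2l ?lee_fin//.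
    by rewrite mulr_ge0// ltW// dyadic_const_gt0.
  by rewrite -energyE// energy_le.
rewrite lee_fin.
pose ew := entropy_weight eps.
have ew0 x : 0 <= ew x := ltW (entropy_weight_gt0 eps_nd delta0 eps1 x).
have ewn x y : x <= y -> ew y <= ew x.
  exact: (entropy_weight_noninc eps_nd delta0 eps1).
have ewi := entropy_weight_int eps_nd delta0 eps1 eps_int.
apply: (@bellman_bound _ _ _ subcube vol phi (mass s) _ _ _ _ _ _
  (energy s p f) (mass w) p K (2 * (delta^-1 + 1))
  (fun x => 2 * primitive ew (x / 2)) (fun x => ew (x / 2))) => //.
- exact: vol_gt0.
- exact: mass_ge0.
- exact: abs_mass_ge0.
- exact: vol_add.
- exact: (abs_mass_add p1).
- exact: mass_add.
- exact: mass_ge0.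
- exact: energy_add.
- exact: mass_add.
- by move=> P; exact: abs_mass_eq0.
- by move=> P; exact: jensen_energy.
- by rewrite mul0r primitive0 mulr0.
- by move=> x x0; rewrite ler_pM2l// (primitive_bound ew0 ewn ewi).
- by move=> x y x0 xy; rewrite ewn// ler_pM2r.
- move=> x y x0 y0.
  have := @primitive_supergradient _ ew _ ew0 ewn ewi (x / 2) (y / 2).
  rewrite !divr_ge0// => /(_ isT isT).
  rewrite -(ler_pM2l (ltr0Sn R 1)) => /le_trans; apply.
  by rewrite le_eqVlt; apply/orP; left; apply/eqP; field.
- by move=> k Q' sQ'; exact: (@entropy_bump_cube _ _ s w p delta K eps).
Qed.

(* Over the root of scale [2^n] use [2 n + 1] generations, so that the sides of
   the cubes considered run from [3 * 2^n] down to [3 * 2^-n]. *)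
Let D n (x : T) : \bar R := ((((6 ^+ d) `^ p)%:E) *
  \sum_(c : bits) ((fun y => (W n.*2.+1 (root_cube n c) y `^ p)%:E)
                     \_ (box (root_cube n c))) x)%E.

Let mW n c : measurable_fun setT
  (fun y => (W n.*2.+1 (root_cube n c) y `^ p)%:E).
Proof.
apply/measurable_EFinP; apply: (measurableT_comp (measurable_powR p)).
exact: measurable_dyadic_max.
Qed.

Let mWr n c : measurable_fun setT
  ((fun y => (W n.*2.+1 (root_cube n c) y `^ p)%:E) \_ (box (root_cube n c))).
Proof.
apply: (measurable_restrictT _ (measurable_box _)).1.
exact: measurable_funTS.
Qed.

Let Wr_ge0 n c x : (0 <= ((fun y => (W n.*2.+1 (root_cube n c) y `^ p)%:E)
  \_ (box (root_cube n c))) x)%E.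
Proof. by apply: erestrict_ge0 => y _; rewrite lee_fin powR_ge0. Qed.

Let D_ge0 n x : (0 <= D n x)%E.
Proof. by rewrite mule_ge0 ?lee_fin ?powR_ge0// sume_ge0. Qed.

Let mD n : measurable_fun setT (D n).
Proof. by apply: measurable_funeM; exact: emeasurable_sum. Qed.

Lemma integral_D n : (\int[weight_measure w]_x D n x <=
  (maximal_const * K)%:E * \int[nu]_x (`|f x| `^ p)%:E)%E.
Proof.
rewrite ge0_integralZl_EFin ?powR_ge0//; last 2 first.
- by move=> x _; rewrite sume_ge0.
- exact: emeasurable_sum.
rewrite ge0_integral_sum//.
have -> : maximal_const * K =
    (6 ^+ d) `^ p * (#|{: bits}|%:R * (dyadic_const * K)).
  by rewrite /maximal_const; ring.
rewrite EFinM -muleA lee_wpmul2l ?lee_fin ?powR_ge0//.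
apply: (@le_trans _ _ (\sum_(c : bits)
  ((dyadic_const * K)%:E * \int[nu]_x (`|f x| `^ p)%:E))%E).
  by apply: lee_sum => c _; rewrite -integral_mkcond; exact: dyadic_bound.
by rewrite sumr_const [in leRHS]EFinM -muleA mule_natl.
Qed.

(** Each average in the supremum is eventually dominated by [D n x]; from which
    [n] on depends on the cube, whence the lower limit. *)
Lemma maximal_le_liminf x :
  (maximal (s \* f)%R x `^ p <= limn_einf (D ^~ x))%E.
Proof.
set B := limn_einf _.
have B0 : (0 <= B)%E by apply: limn_einf_ge; exact: nearW.
suff H : (maximal (s \* f)%R x <= B `^ p^-1)%E.
  apply: (@le_trans _ _ ((B `^ p^-1) `^ p)%E).
    by rewrite gt0_ler_poweR ?(ltW p0)// in_itv/= ?leey ?maximal_ge0 ?poweR_ge0.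
  by rewrite -poweRrM mulVf ?gt_eqF// poweRe1.
apply: ge_ereal_sup => _ [_ [[l l0 [a ->]] ax] <-].
set A := average _ _.
have A0 : (0 <= A)%E by exact: average_ge0.
suff AB : (A `^ p <= B)%E.
  rewrite -[A in (A <= _)%E]poweRe1// -(divff (lt0r_neq0 p0)) poweRrM.
  by rewrite gt0_ler_poweR ?invr_ge0 ?(ltW p0)// in_itv/= ?leey ?poweR_ge0 ?B0.
apply: limn_einf_ge; have := cover_by_descendant a l0.
apply: filterS => n [c [k [P [kn dP aP Pl]]]].
have Px := aP _ ax.
have := average_le_descendant p1 mf f_fin l0 aP Pl; rewrite -/A => AP.
apply: (@le_trans _ _ ((6 ^+ d * (phi P / vol P)) `^ p)%:E).
  rewrite -poweR_EFin gt0_ler_poweR ?(ltW p0)// in_itv/= ?leey ?A0//.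
  by rewrite (le_trans A0 AP).
have av0 : 0 <= phi P / vol P by rewrite divr_ge0 ?abs_mass_ge0// ltW// vol_gt0.
rewrite powRM ?exprn_ge0// EFinM lee_wpmul2l ?lee_fin ?powR_ge0//.
rewrite (bigD1 c)// -[leLHS]adde0 leeD//; last by rewrite sume_ge0.
rewrite patchE mem_set; last exact: (descendant_sub dP).
rewrite lee_fin ge0_ler_powR ?nnegrE ?(ltW p0)//.
  exact: dyadic_max_ge0.
exact: (@dyadic_max_descendant _ _ (fun P => phi P / vol P) _ _ _ _ _ _ kn dP Px).
Qed.

Lemma maximal_strong_type :
  (\int[weight_measure w]_x (maximal (s \* f)%R x `^ p) <=
   (maximal_const * K)%:E * \int[nu]_x (`|f x| `^ p)%:E)%E.
Proof.
apply: (@le_trans _ _ (\int[weight_measure w]_x limn_einf (D ^~ x))%E).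
  by apply: le_lower_integral => x _; [exact: poweR_ge0|exact: maximal_le_liminf].
apply: le_trans (fatou _ measurableT _ _) _ => //.
by apply: limn_einf_le; exact: integral_D.
Qed.

End fixed_function.

Local Notation maximal_const := (maximal_const d p delta).

Lemma maximal_norm_le :
  (maximal_norm s w p <= (maximal_const `^ p^-1 * K `^ p^-1)%:E)%E.
Proof.
apply: ereal_inf_lbound; exists (maximal_const `^ p^-1 * K `^ p^-1) => //.
split; first by rewrite mulr_ge0 ?powR_ge0.
move=> f /andP[/set_mem mf ff].
have pn0 : p != 0 by rewrite gt_eqF.
have E : ('N[nu]_p%:E[EFin \o f] = (\int[nu]_x (`|f x| `^ p)%:E) `^ p^-1)%E.
  by rewrite unlock; congr (_ `^ _)%E; apply: eq_integral => x _ /=.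
have f_fin : (\int[nu]_x (`|f x| `^ p)%:E < +oo)%E.
  move: (set_mem ff); rewrite /= /finite_norm E => /lty_poweRy; apply.
  by rewrite invr_neq0.
have CK0 : 0 <= maximal_const * K.
  by rewrite mulr_ge0// ltW// (maximal_const_gt0 d p1 delta0).
have F0 : (0 <= \int[nu]_x (`|f x| `^ p)%:E)%E.
  by apply: integral_ge0 => x _; rewrite lee_fin powR_ge0.
rewrite E unlock.
under eq_integral do rewrite gee0_abs ?maximal_ge0//.
apply: (@le_trans _ _ (((maximal_const * K)%:E *
    \int[nu]_x (`|f x| `^ p)%:E) `^ p^-1)%E).
  rewrite gt0_ler_poweR ?invr_ge0 ?(ltW p0)// ?in_itv/= ?leey ?andbT.
  - by apply: integral_ge0 => x _; exact: poweR_ge0.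
  - by rewrite mule_ge0.
  - exact: maximal_strong_type.
rewrite poweRM// poweR_EFin powRM// ltW// (maximal_const_gt0 d p1 delta0)//.
Qed.

End maximal_bound.

(* The constant c depends only on d, p and a positive lower bound of eps. *)
Theorem theorem1p2 (R : realType) (d : nat) (p delta : R) :
  (0 < d)%N -> 1 < p -> 0 < delta ->
  exists2 c : R, 0 < c &
  forall (sigma w : weight R d) (eps : R -> R),
    {in `[1, +oo[ &, {homo eps : s t / s <= t}} ->
    delta <= eps 1 ->
    (\int[lebesgue_measure]_(t in `[1%R, +oo[) ((eps t * t)^-1)%:E = 1)%E ->
    (maximal_norm sigma w p <=
       c%:E * entropy_bump sigma w p eps `^ p^-1)%E.
Proof.
move=> _ p1 delta0; have p0 : 0 < p by exact: lt_trans p1.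
exists (maximal_const d p delta `^ p^-1).
  by rewrite powR_gt0// (maximal_const_gt0 d p1 delta0).
move=> sigma w eps eps_nd eps1 eps_int.
have := entropy_bump_ge0 sigma w p delta0 eps_nd eps1.
have := @maximal_norm_le R d sigma w p delta _ eps p1 delta0 eps_nd eps1 eps_int.
case: (entropy_bump _ _ _ _) => [K|_ _|_]; last by rewrite leeNy_eq.
  by rewrite lee_fin poweR_EFin -EFinM => H K0; exact: H.
rewrite poweRyr ?invr_neq0 ?gt_eqF// gt0_muley ?leey//.
by rewrite lte_fin powR_gt0// (maximal_const_gt0 d p1 delta0).
Qed.
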